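(* Let $F$ be a field. There exists a continuum (a family of cardinality $2^{\aleph_0}$) of pairwise non-isomorphic projectively simple monomial $F$-algebras of quadratic growth having equal Hilbert series and pairwise isomorphic proalgebraic varieties of point modules.
   Context: A monomial algebra is a quotient $A=F\langle x_1,\dots,x_m\rangle/I$ of a free associative algebra by an ideal generated by monomials, graded by $\deg x_i=1$. It has quadratic growth if $\dim_F\bigoplus_{i\le n}A_i\sim n^2$, where $f\preceq g$ means $f(n)\le g(Cn)$ for some $C>0$ and all $n$, and $f\sim g$ means $f\preceq g\preceq f$. Its Hilbert series is $\sum_n(\dim_FA_n)t^n$. A graded algebra is projectively simple if it is infinite-dimensional but all its proper graded homomorphic images are finite-dimensional. A point module is a graded cyclic right $A$-module $P=\bigoplus_{n\ge0}P_n$ generated in degree $0$ with all $\dim_F P_n=1$. Writing $P_i=Fe_i$, $e_i\cdot x_j=\lambda_{i,j}e_{i+1}$, its isomorphism class is recorded by $(\underline\lambda_0,\underline\lambda_1,\dots)\in\mathbb P^{m-1}\times\mathbb P^{m-1}\times\cdots$, $\underline\lambda_i=[\lambda_{i,1}:\cdots:\lambda_{i,m}]$. Let $\mathcal P_n(A)\subseteq(\mathbb P^{m-1})^{\times(n+1)}$ be the projection of the set of all such sequences to the first $n+1$ factors (a projective variety) and $\pi_n\colon\mathcal P_{n+1}(A)\to\mathcal P_n(A)$ the natural projection. The proalgebraic variety of point modules is $\mathcal P(A)=\{(\mathcal P_n(A),\pi_n)\}_{n\ge0}$. A proalgebraic variety is a sequence $\{(V_n,\varphi_n)\}_{n\ge0}$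 of algebraic varieties and surjective morphisms $\varphi_n\colon V_{n+1}\to V_n$; $\varphi^{i'}_i\colon V_{i'}\to V_i$ denotes the composite. Points are compatible sequences. A morphism $\{(V_n,\varphi_n)\}\to\{(W_n,\psi_n)\}$ consists of an order-preserving $g\colon\mathbb N\to\mathbb N$ (possibly defined only for large arguments) and morphisms of varieties $f_j\colon V_{g(j)}\to W_j$ with $f_j\circ\varphi^{g(j')}_{g(j)}=\psi^{j'}_j\circ f_{j'}$ for $j\le j'$; it induces a map on points. An isomorphism is a morphism with an inverse morphism, i.e. the induced maps on points are mutually inverse. *)

(* Defs.v *)
(* MathComp, with mathcomp.classical for sets and choice, and the monoid
   algebras {malg R[K]} of multinomials. *)
From HB Require Import structures.
From mathcomp Require Import all_boot all_order all_algebra.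
From mathcomp Require Import boolp classical_sets.
From mathcomp Require Import finmap monalg.

Set Implicit Arguments.
Unset Strict Implicit.
Unset Printing Implicit Defensive.

Import GRing.Theory.
Local Open Scope quotient_scope.
Local Open Scope classical_set_scope.
Local Open Scope ring_scope.

(** * Linear algebra in modules that need not be finite-dimensional *)

Section Dimension.
Variables (F : fieldType) (M : lmodType F).
Implicit Type V : set M.

Definition has_dim V (d : nat) : Prop :=
  exists b : 'I_d -> M,
    [/\ forall i, V (b i),
        forall c : 'I_d -> F, \sum_i c i *: b i = 0 -> forall i, c i = 0 &
        forall v, V v -> exists c : 'I_d -> F, v = \sum_i c i *: b i].

Definition finite_dim V : Prop := exists d, has_dim V d.

(* The dimension of a subspace; 0 by convention if it is infinite. *)
Definition dimension V : nat := xget 0%N [set d | has_dim V d].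

Definition is_subspace V : Prop :=
  V 0 /\ forall (c : F) x y, V x -> V y -> V (c *: x + y).

(* M is the direct sum of the subspaces G 0, G 1, ... *)
Definition is_grading (G : nat -> set M) : Prop :=
  [/\ forall n, is_subspace (G n),
      forall x, exists N (a : nat -> M),
        (forall n, G n (a n)) /\ x = \sum_(n < N) a n &
      forall N (a : nat -> M), (forall n, G n (a n)) ->
        \sum_(n < N) a n = 0 -> forall n, (n < N)%N -> a n = 0].

End Dimension.

(** * Two-sided ideals and quotient algebras *)

Definition two_sided_ideal (R : nzRingType) (J : set R) : Prop :=
  [/\ J 0, forall x y, J x -> J y -> J (x - y),
      forall a x, J x -> J (a * x) & forall a x, J x -> J (x * a)].

(* Algebras in MathComp are nonzero, so only proper ideals have a quotient. *)
Record proper_ideal2 (R : nzRingType) := ProperIdeal2 {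
  ideal2_set : set R;
  ideal2P : two_sided_ideal ideal2_set;
  ideal2_proper : ~ ideal2_set 1 }.

Definition ideal2_pred (R : nzRingType) (J : proper_ideal2 R) : R -> bool :=
  fun x => `[< ideal2_set J x >].

Section QuotientAlgebra.
Variables (F : fieldType) (A : algType F) (J : proper_ideal2 A).

Lemma ideal2E x : (x \in ideal2_pred J) = `[< ideal2_set J x >]. Proof. by []. Qed.

Lemma ideal2_zmod_closed : zmod_closed (ideal2_pred J).
Proof.
have [J0 JB _ _] := ideal2P J.
by split=> [|x y]; rewrite !ideal2E; [exact/asboolP |
  move=> /asboolP Jx /asboolP Jy; apply/asboolP/JB].
Qed.

HB.instance Definition _ :=
  GRing.isZmodClosed.Build A (ideal2_pred J) ideal2_zmod_closed.

Lemma ideal2Ml a x : x \in ideal2_pred J -> a * x \in ideal2_pred J.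
Proof.
have [_ _ JM _] := ideal2P J.
by rewrite !ideal2E => /asboolP Jx; apply/asboolP/JM.
Qed.

Lemma ideal2Mr a x : x \in ideal2_pred J -> x * a \in ideal2_pred J.
Proof.
have [_ _ _ JM] := ideal2P J.
by rewrite !ideal2E => /asboolP Jx; apply/asboolP/JM.
Qed.

Definition quotient_algebra : Type :=
  Quotient.quot (GRing.ZmodClosed.clone A (ideal2_pred J) _).

HB.instance Definition _ := GRing.Zmodule.on quotient_algebra.
HB.instance Definition _ := EqQuotient.on quotient_algebra.

Local Notation Q := quotient_algebra.

Definition quotient_one : Q := lift_cst Q 1.
Definition quotient_mul := lift_op2 Q *%R.
Definition quotient_scale (c : F) := lift_op1 Q ( *:%R c).

Lemma quotient_eqP (x y : A) :
  reflect (\pi_Q x = \pi_Q y) (x - y \in ideal2_pred J).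
Proof.
by apply: (iffP idP) => [xy|/eqP]; [apply/eqP|];
  rewrite -[_ == _]Quotient.idealrBE.
Qed.

Lemma quotient_piD : {morph \pi_Q : x y / x + y}.
Proof. by move=> x y; exact: Quotient.pi_add. Qed.

Lemma quotient_repr (x : A) : x - repr (\pi_Q x) \in ideal2_pred J.
Proof. by apply/quotient_eqP; rewrite reprK. Qed.

Lemma quotient_piM : {morph \pi_Q : x y / x * y >-> quotient_mul x y}.
Proof.
move=> x y; unlock quotient_mul; apply/quotient_eqP.
rewrite -[x * y](subrK (x * repr (\pi_Q y))) -mulrBr -addrA -mulrBl.
by apply: rpredD; [apply: ideal2Ml|apply: ideal2Mr]; apply: quotient_repr.
Qed.

Lemma quotient_piZ c : {morph \pi_Q : x / c *: x >-> quotient_scale c x}.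
Proof.
move=> x; unlock quotient_scale; apply/quotient_eqP.
by rewrite -scalerBr -mulr_algl ideal2Ml ?quotient_repr.
Qed.

Lemma quotient_pi1 : quotient_one = \pi_Q 1.
Proof. by unlock quotient_one. Qed.

Lemma quotient_mulA : associative quotient_mul.
Proof.
move=> x y z; rewrite -[x]reprK -[y]reprK -[z]reprK.
by rewrite -!quotient_piM mulrA.
Qed.

Lemma quotient_mul1 : left_id quotient_one quotient_mul.
Proof.
by move=> x; rewrite -[x]reprK quotient_pi1 -quotient_piM mul1r.
Qed.

Lemma quotient_mulr1 : right_id quotient_one quotient_mul.
Proof.
by move=> x; rewrite -[x]reprK quotient_pi1 -quotient_piM mulr1.
Qed.

Lemma quotient_mulDl : left_distributive quotient_mul +%R.
Proof.
move=> x y z; rewrite -[x]reprK -[y]reprK -[z]reprK.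
by rewrite -quotient_piD -!quotient_piM mulrDl quotient_piD.
Qed.

Lemma quotient_mulDr : right_distributive quotient_mul +%R.
Proof.
move=> x y z; rewrite -[x]reprK -[y]reprK -[z]reprK.
by rewrite -quotient_piD -!quotient_piM mulrDr quotient_piD.
Qed.

Lemma quotient_pi0 : \pi_Q 0 = 0.
Proof. by apply: (addrI (\pi_Q 0)); rewrite -quotient_piD !addr0. Qed.

Lemma quotient_oner_neq0 : quotient_one != 0.
Proof.
rewrite quotient_pi1 -quotient_pi0; apply/eqP => /quotient_eqP.
by rewrite subr0 ideal2E => /asboolP; exact: ideal2_proper.
Qed.

HB.instance Definition _ := GRing.Zmodule_isNzRing.Build Q
  quotient_mulA quotient_mul1 quotient_mulr1 quotient_mulDl quotient_mulDr
  quotient_oner_neq0.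

Lemma quotient_scaleA a b (x : Q) :
  quotient_scale a (quotient_scale b x) = quotient_scale (a * b) x.
Proof. by rewrite -[x]reprK -!quotient_piZ scalerA. Qed.

Lemma quotient_scale1 : left_id 1 quotient_scale.
Proof. by move=> x; rewrite -[x]reprK -quotient_piZ scale1r. Qed.

Lemma quotient_scaleDr : right_distributive quotient_scale +%R.
Proof.
move=> a x y; rewrite -[x]reprK -[y]reprK.
by rewrite -quotient_piD -!quotient_piZ scalerDr quotient_piD.
Qed.

Lemma quotient_scaleDl (x : Q) :
  {morph quotient_scale^~ x : a b / a + b}.
Proof.
by move=> a b; rewrite -[x]reprK -!quotient_piZ scalerDl quotient_piD.
Qed.

HB.instance Definition _ := GRing.Zmodule_isLmodule.Build F Q
  quotient_scaleA quotient_scale1 quotient_scaleDr quotient_scaleDl.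

Lemma quotient_scaleAl a (x y : Q) : a *: (x * y) = (a *: x) * y.
Proof.
change (quotient_scale a (quotient_mul x y)
  = quotient_mul (quotient_scale a x) y).
rewrite -[x]reprK -[y]reprK.
by rewrite -quotient_piM -!quotient_piZ -quotient_piM scalerAl.
Qed.

HB.instance Definition _ :=
  GRing.Lmodule_isLalgebra.Build F Q quotient_scaleAl.

Lemma quotient_scaleAr a (x y : Q) : a *: (x * y) = x * (a *: y).
Proof.
change (quotient_scale a (quotient_mul x y)
  = quotient_mul x (quotient_scale a y)).
rewrite -[x]reprK -[y]reprK.
by rewrite -quotient_piM -!quotient_piZ -quotient_piM scalerAr.
Qed.

HB.instance Definition _ :=
  GRing.Lalgebra_isAlgebra.Build F Q quotient_scaleAr.

End QuotientAlgebra.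

(** * Monomial algebras *)

(* The free associative algebra F<x_0, ..., x_(m-1)>: the monoid algebra of the
   free monoid of words in 'I_m. *)
Definition free_algebra (F : fieldType) (m : nat) : Type :=
  {malg F[{fmonom 'I_m}]}.

Section FreeAlgebra.
Variables (F : fieldType) (m : nat).

HB.instance Definition _ := GRing.Lalgebra.on (free_algebra F m).

Lemma free_scaleAr (a : F) (x y : free_algebra F m) :
  a *: (x * y) = x * (a *: y).
Proof.
have ca (z : free_algebra F m) : z * a%:MP = a%:MP * z.
  rewrite [z]monalgE mulr_suml mulr_sumr; apply: eq_bigr => k _.
  by rewrite /malgC !malgM_def !fgmulUU mulrC mulm1 mul1m.
by rewrite -!mul_malgC mulrA -ca -mulrA.
Qed.

HB.instance Definition _ :=
  GRing.Lalgebra_isAlgebra.Build F (free_algebra F m) free_scaleAr.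

Definition free_word (w : seq 'I_m) : free_algebra F m :=
  << 1 *g FMonom w >>.

(* Homogeneous elements of degree n, for deg x_i = 1. *)
Definition free_homog (n : nat) : set (free_algebra F m) :=
  [set p : free_algebra F m | forall w, w \in msupp p -> size (fmonom_val w) = n].

End FreeAlgebra.

(* A set of words generating the ideal of relations.  The relations have
   positive degree, so that the quotient is connected graded. *)
Record monomial_data := MonomialData {
  nvars : nat;
  mrels : set (seq 'I_nvars);
  mrels_proper : ~ mrels [::] }.

Section MonomialAlgebra.
Variables (F : fieldType) (D : monomial_data).
Local Notation m := (nvars D).

Definition relation_ideal : set (free_algebra F m) :=
  smallest (@two_sided_ideal (free_algebra F m)) (@free_word F m @` @mrels D).

Lemma relation_idealP : two_sided_ideal relation_ideal.
Proof.
split=> [J [[]] //|x y Ix Iy J JW|a x Ix J JW|a x Ix J JW].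
- by have [[_ JB _ _] _] := JW; apply: JB; [exact: Ix|exact: Iy].
- by have [[_ _ JM _] _] := JW; apply: JM; exact: Ix.
- by have [[_ _ _ JM] _] := JW; apply: JM; exact: Ix.
Qed.

Lemma relation_ideal_proper : ~ relation_ideal 1.
Proof.
pose one : {fmonom 'I_m} := mone.
pose J := [set x : free_algebra F m | mcoeff one x = 0].
have coefM (x y : free_algebra F m) :
    mcoeff one (x * y) = mcoeff one x * mcoeff one y.
  exact: (rmorphM (@mcoeff {fmonom 'I_m} F mone)).
move=> I1; have: J 1.
  apply: I1; split=> [|_ [w Ww <-]] /=; last first.
    rewrite /J /= /free_word mcoeffU.
    case: eqP => // /(congr1 (@fmonom_val _)); rewrite fm1 /= => w0.
    by case: (@mrels_proper D); rewrite -w0.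
  rewrite /J; split=> /= [|x y x0 y0|a x x0|a x x0].
  - by rewrite mcoeff0.
  - by rewrite mcoeffB x0 y0 subrr.
  - by rewrite coefM x0 mulr0.
  - by rewrite coefM x0 mul0r.
by rewrite /J /= mcoeff1 eqxx => /eqP; rewrite oner_eq0.
Qed.

Definition monomial_algebra :=
  quotient_algebra (ProperIdeal2 relation_idealP relation_ideal_proper).

HB.instance Definition _ := GRing.Algebra.on monomial_algebra.

Definition to_monomial (p : free_algebra F m) : monomial_algebra :=
  \pi_monomial_algebra p.

Definition mon_gen (j : 'I_m) : monomial_algebra :=
  to_monomial (free_word F [:: j]).

Definition mon_homog (n : nat) : set monomial_algebra :=
  to_monomial @` free_homog n.

(* The coefficients dim_F A_n of the Hilbert series of A. *)
Definition hilbert_series (n : nat) : nat := dimension (mon_homog n).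

Definition growth_function (n : nat) : nat :=
  dimension [set x | exists a : nat -> monomial_algebra,
    (forall i, mon_homog i (a i)) /\ x = \sum_(i < n.+1) a i].

Definition graded_ideal (J : set monomial_algebra) : Prop :=
  forall x, J x -> exists N (a : nat -> monomial_algebra),
    (forall i, mon_homog i (a i) /\ J (a i)) /\ x = \sum_(i < N) a i.

(* The zero algebra, which is the quotient by the improper ideal, is
   finite-dimensional, so that it may be left out. *)
Definition projectively_simple : Prop :=
  ~ finite_dim [set: monomial_algebra] /\
  forall J : proper_ideal2 monomial_algebra, graded_ideal (ideal2_set J) ->
    (exists2 x, ideal2_set J x & x != 0) -> finite_dim [set: quotient_algebra J].

End MonomialAlgebra.

Definition alg_isomorphic (F : fieldType) (A B : algType F) : Prop :=
  exists f : {lrmorphism A -> B}, bijective f.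

(* Growth functions are compared on positive integers: at n = 0 no algebra
   satisfies dim A_0 = 1 <= (C * 0) ^ 2. *)
Definition growth_le (f g : nat -> nat) : Prop :=
  exists2 C, (0 < C)%N & forall n, (0 < n)%N -> (f n <= g (C * n))%N.

Definition growth_equiv (f g : nat -> nat) : Prop :=
  growth_le f g /\ growth_le g f.

Definition quadratic_growth (F : fieldType) (D : monomial_data) : Prop :=
  growth_equiv (growth_function F D) (fun n => n ^ 2)%N.

(** * Point modules *)

Record right_module (F : fieldType) (A : algType F) := RightModule {
  rm_sort :> lmodType F;
  rm_act : rm_sort -> A -> rm_sort;
  rm_linl : forall a (c : F) x y,
    rm_act (c *: x + y) a = c *: rm_act x a + rm_act y a;
  rm_linr : forall x (c : F) a b,
    rm_act x (c *: a + b) = c *: rm_act x a + rm_act x b;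
  rm_act1 : forall x, rm_act x 1 = x;
  rm_actM : forall x a b, rm_act x (a * b) = rm_act (rm_act x a) b }.

Record point_module (F : fieldType) (D : monomial_data) := PointModule {
  pm_module :> right_module (monomial_algebra F D);
  pm_comp : nat -> set pm_module;
  pm_grading : is_grading pm_comp;
  pm_graded : forall n k x a, pm_comp n x -> mon_homog k a ->
    pm_comp (n + k)%N (rm_act x a);
  pm_cyclic : exists2 x0, pm_comp 0%N x0 &
    forall x : pm_module, exists a, x = rm_act x0 a;
  pm_dim1 : forall n, has_dim (pm_comp n) 1 }.

(* The projective space P^(m-1)(K) of lines in K^m. *)
Definition pspace (K : fieldType) (m : nat) : Type :=
  {L : {vspace 'rV[K]_m} | \dim L == 1%N}.

Definition point_sequence (F : fieldType) (D : monomial_data)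
    (z : nat -> pspace F (nvars D)) : Prop :=
  exists (P : point_module F D) (e : nat -> P)
         (lam : nat -> 'rV[F]_(nvars D)),
    [/\ forall i, pm_comp i = [set c *: e i | c in [set: F]],
        forall i j, rm_act (e i) (mon_gen F j) = lam i 0 j *: e i.+1 &
        forall i, val (z i) = <[lam i]>%VS].

(** * Varieties and proalgebraic varieties *)

(* (P^(m-1)(K))^k *)
Definition mpspace (K : fieldType) (k m : nat) : Type := {ffun 'I_k -> pspace K m}.

(* The rows of v are homogeneous coordinates of the components of q. *)
Definition hcoords (K : fieldType) (k m : nat) (q : mpspace K k m)
    (v : 'M[K]_(k, m)) : Prop :=
  forall i, val (q i) = <[row i v]>%VS.

(* A variety over F in a product of projective spaces, given by its points over
   every extension field K of F.  For F algebraically closed the points over F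
   carry all the information; in general, in particular if F is finite, they do
   not.  Being Zariski closed is left out of the structure: morphisms only
   depend on the sets of points. *)
Record variety (F : fieldType) := Variety {
  var_factors : nat;
  var_coords : nat;
  var_points :> forall K : fieldType, {rmorphism F -> K} ->
    set (mpspace K var_factors var_coords) }.

(* Polynomials in the k blocks of m homogeneous coordinates. *)
Definition mhpoly (F : fieldType) (k m : nat) : Type :=
  {malg F[{cmonom ('I_k * 'I_m)%type}]}.

Definition multihomogeneous (F : fieldType) (k m : nat) (d : 'I_k -> nat)
    (p : mhpoly F k m) : Prop :=
  forall mon, mon \in msupp p ->
    forall i, (\sum_(j < m) mon (i, j))%N = d i.

Definition mheval (F : fieldType) (k m : nat) (K : fieldType)
    (iota : {rmorphism F -> K}) (p : mhpoly F k m) (v : 'M[K]_(k, m)) : K :=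
  \sum_(mon <- msupp p)
    iota (p@_mon) * \prod_(ij : 'I_k * 'I_m) v ij.1 ij.2 ^+ mon ij.

Section Coordinates.
Variables (F : fieldType) (k m : nat).

Definition mhvar (i : 'I_k) (j : 'I_m) : mhpoly F k m := << 1 *g ucm (i, j) >>.

Lemma mhvar_homog i j :
  multihomogeneous (fun i' => (i' == i : nat)) (mhvar i j).
Proof.
move=> mon; rewrite /mhvar msuppU oner_eq0 inE => /eqP -> i'.
rewrite (bigD1 j) //= big1 => [|j' /negPf jj']; rewrite ucmE xpair_eqE.
  by rewrite eqxx andbT addn0 eq_sym.
by rewrite [j == _]eq_sym jj' andbF.
Qed.

Lemma mheval_var (K : fieldType) (iota : {rmorphism F -> K}) i j
    (v : 'M[K]_(k, m)) : mheval iota (mhvar i j) v = v i j.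
Proof.
rewrite /mheval /mhvar msuppU oner_eq0 big_seq_fset1 mcoeffUU rmorph1 mul1r.
rewrite (bigD1 (i, j)) //= big1 => [|[i' j'] /negPf ij]; rewrite ucmE.
  by rewrite eqxx expr1 mulr1.
by rewrite eq_sym ij expr0.
Qed.

Lemma mheval_row (K : fieldType) (iota : {rmorphism F -> K}) i
    (v : 'M[K]_(k, m)) : \row_j mheval iota (mhvar i j) v = row i v.
Proof. by apply/rowP => j; rewrite !mxE mheval_var. Qed.

Lemma hcoords_neq0 (K : fieldType) (q : mpspace K k m) v i :
  hcoords q v -> row i v != 0.
Proof.
move=> /(_ i) qi; have := valP (q i); rewrite qi dim_vline.
by case: (_ != 0).
Qed.

End Coordinates.

Section Morphisms.
Variables (F : fieldType) (X Y : variety F).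

Definition point_maps : Type :=
  forall (K : fieldType) (iota : {rmorphism F -> K}), X K iota -> Y K iota.

(* Every component of f is given, near every point, by multihomogeneous
   polynomials over F of the same multidegree without common zero. *)
Definition is_regular (f : point_maps) : Prop :=
  forall (K : fieldType) (iota : {rmorphism F -> K}) (x : X K iota)
         (i : 'I_(var_factors Y)),
  exists (d : 'I_(var_factors X) -> nat)
         (p : 'I_(var_coords Y) -> mhpoly F (var_factors X) (var_coords X)),
  [/\ forall j, multihomogeneous d (p j),
      forall v, hcoords (val x) v -> \row_j mheval iota (p j) v != 0 &
      forall (L : fieldType) (kappa : {rmorphism F -> L}) (y : X L kappa) v,
        hcoords (val y) v -> \row_j mheval kappa (p j) v != 0 ->
        val (val (f L kappa y) i) = <[\row_j mheval kappa (p j) v]>%VS].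

Record morphism := Morphism {
  mor_map :> forall (K : fieldType) (iota : {rmorphism F -> K}),
    X K iota -> Y K iota;
  mor_regular : is_regular mor_map }.

End Morphisms.

Record proalg_variety (F : fieldType) := ProalgVariety {
  pro_var :> nat -> variety F;
  pro_map : forall n, morphism (pro_var n.+1) (pro_var n);
  pro_surj : forall n (K : fieldType) (iota : {rmorphism F -> K}),
    forall y, exists x, pro_map n K iota x = y }.

Section ProalgMorphisms.
Variable F : fieldType.
Implicit Types X Y : proalg_variety F.

Fixpoint pro_iter X (i d : nat) (K : fieldType) (iota : {rmorphism F -> K}) :
    X (d + i)%N K iota -> X i K iota :=
  match d return X (d + i)%N K iota -> X i K iota with
  | 0 => fun x => x
  | d'.+1 => fun x => pro_iter (pro_map X (d' + i)%N K iota x)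
  end.

(* The composite X_i' -> X_i for i <= i'. *)
Definition pro_trans X (i i' : nat) (le_ii' : (i <= i')%N)
    (K : fieldType) (iota : {rmorphism F -> K}) (x : X i' K iota) :
    X i K iota :=
  @pro_iter X i (i' - i) K iota
    (ecast n (X n K iota) (esym (subnK le_ii')) x).

Record pro_morphism X Y := ProMorphism {
  prom_start : nat;
  prom_index : nat -> nat;
  prom_index_homo : forall j j',
    (prom_start <= j)%N -> (j <= j')%N -> (prom_index j <= prom_index j')%N;
  prom_fun : forall j, (prom_start <= j)%N -> morphism (X (prom_index j)) (Y j);
  prom_compat : forall j j' (hj : (prom_start <= j)%N) (hj' : (prom_start <= j')%N)
      (le_jj' : (j <= j')%N) (K : fieldType) (iota : {rmorphism F -> K})
      (x : X (prom_index j') K iota),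
    prom_fun hj K iota (pro_trans (prom_index_homo hj le_jj') x)
      = pro_trans le_jj' (prom_fun hj' K iota x) }.

Definition pro_point X (K : fieldType) (iota : {rmorphism F -> K})
    (x : forall n, X n K iota) : Prop :=
  forall n, pro_map X n K iota (x n.+1) = x n.

(* The components of small index, where f is not defined, are obtained by
   projecting the first one at which it is. *)
Definition induced_map X Y (f : pro_morphism X Y)
    (K : fieldType) (iota : {rmorphism F -> K}) (x : forall n, X n K iota) :
    forall n, Y n K iota :=
  fun n => pro_trans (leq_maxr (prom_start f) n)
    (prom_fun (leq_maxl (prom_start f) n) K iota
       (x (prom_index f (maxn (prom_start f) n)))).

Definition pro_isomorphic X Y : Prop :=
  exists (f : pro_morphism X Y) (h : pro_morphism Y X),
  forall (K : fieldType) (iota : {rmorphism F -> K}),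
    (forall x, @pro_point X K iota x ->
      forall n, induced_map h (induced_map f x) n = x n) /\
    (forall y, @pro_point Y K iota y ->
      forall n, induced_map f (induced_map h y) n = y n).

End ProalgMorphisms.

(** * The proalgebraic variety of point modules *)

Section PointVariety.
Variables (F : fieldType) (D : monomial_data).
Local Notation m := (nvars D).

Definition truncate (K : fieldType) (n : nat) (z : nat -> pspace K m) :
    mpspace K n.+1 m := [ffun i : 'I_n.+1 => z i].

(* Base change to K of a monomial algebra is the monomial algebra over K with
   the same relations. *)
Definition point_variety_level (n : nat) : variety F :=
  @Variety F n.+1 m (fun K _ =>
    [set q | exists2 z, @point_sequence K D z & q = truncate n z]).

Definition drop_last (K : fieldType) (n : nat) (q : mpspace K n.+2 m) :
    mpspace K n.+1 m := [ffun i : 'I_n.+1 => q (widen_ord (leqnSn _) i)].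

Lemma drop_lastE (K : fieldType) n (z : nat -> pspace K m) :
  drop_last (truncate n.+1 z) = truncate n z.
Proof. by apply/ffunP => i; rewrite !ffunE. Qed.

Lemma drop_last_subproof n (K : fieldType) (iota : {rmorphism F -> K})
    (q : point_variety_level n.+1 K iota) :
  drop_last (val q) \in point_variety_level n K iota.
Proof.
case: q => q /= /set_mem /= [z zP ->].
by apply/mem_set; exists z => //; rewrite drop_lastE.
Qed.

Definition point_proj (n : nat) :
    point_maps (point_variety_level n.+1) (point_variety_level n) :=
  fun K iota q => SigSub (drop_last_subproof q).

Lemma point_proj_regular n : is_regular (@point_proj n).
Proof.
move=> K iota x i; pose i' : 'I_n.+2 := widen_ord (leqnSn _) i.
exists (fun j => (j == i' : nat)), (fun j => mhvar F i' j).
split=> [j|v xv|L kappa y v yv _]; first exact: mhvar_homog.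
  by rewrite mheval_row; exact: (hcoords_neq0 i' xv).
by rewrite mheval_row /= ffunE; exact: yv.
Qed.

Lemma point_proj_surj n (K : fieldType) (iota : {rmorphism F -> K}) y :
  exists x, @point_proj n K iota x = y.
Proof.
case: y => y yP; have [z zP yE] := set_mem yP.
have xP : truncate n.+1 z \in point_variety_level n.+1 K iota.
  by apply/mem_set; exists z.
exists (SigSub xP); apply: val_inj => /=.
by rewrite drop_lastE yE.
Qed.

Definition point_proalg : proalg_variety F :=
  @ProalgVariety F point_variety_level
    (fun n => Morphism (@point_proj_regular n)) point_proj_surj.

End PointVariety.

(* Main.v *)
(* Let toep s be the binary sequence whose letter at n = 3^k (3 m + d), d = 1, 2, depends
   on d and on s k only: one residue class mod 3 carries the first letter, one the second,
   and the third again such a sequence, for the shift of s.  The algebra of s is the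
   monomial algebra of the set of factors of toep s.
   - Three consecutive letters determine the residue class of the holes.  Hence there are
     2 n factors of each length n > 0, and the factors determine s.
   - The factors recur with bounded gaps.  Multiplying a homogeneous element so that its
     lexicographically largest word completes the smallest factor of some length kills its
     other words; so nonzero graded ideals contain a word, hence all long words.
   - The degree 1 part of an algebra isomorphism is an invertible matrix, and a nonzero term
     of its determinant is a permutation of the letters mapping factors to factors.
   - A point module is a sequence of points of P^1 whose supporting words are all factors.
     Mixing two supporting words shows that they have the same hole class, so a point module
     truncated to length 3^k is given by k residues and one point of P^1, in the only hole
     left; the truncations form 3^k disjoint projective lines.  Exchanging the residues 1
     and 2 at the levels where s and t differ gives the isomorphism from s to t. *)
Require Import Defs.
From mathcomp Require Import all_boot all_order all_algebra perm.
From mathcomp Require Import zify.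
From mathcomp Require Import boolp classical_sets.
From mathcomp Require Import finmap monalg.

Set Implicit Arguments.
Unset Strict Implicit.
Unset Printing Implicit Defensive.

Import GRing.Theory.
Local Open Scope quotient_scope.
Local Open Scope classical_set_scope.

(** * Toeplitz words *)

Definition shift (s : nat -> bool) : nat -> bool := fun k => s k.+1.

(* [toep s 0] is a junk value. *)
Definition toep (s : nat -> bool) (n : nat) : bool :=
  s (logn 3 n) (+) (n %/ 3 ^ logn 3 n %% 3 == 1).

(* The class r mod 3 carries q; (j + 2 r) mod 3 is the position of j relative to it. *)
Definition expand (T : Type) (l : bool -> T) (b : bool) (r : nat)
    (q : nat -> T) (j : nat) : T :=
  if j %% 3 == r then q (j %/ 3) else l (b (+) ((j + 2 * r) %% 3 == 1)).

(** The limit case of [tower], with class 0 at every level: position 0 is always a hole, and [P]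
    replaces the junk value of [toep]. *)
Definition toep_hole (T : Type) (l : bool -> T) (s : nat -> bool) (P : T) (j : nat) : T :=
  if j == 0 then P else l (toep s j).

(* [ds] lists the hole classes of the first levels; all later classes are 0, and the only
   position that is a hole at every level carries [P]. *)
Fixpoint tower (T : Type) (l : bool -> T) (s : nat -> bool) (ds : seq nat) (P : T)
    : nat -> T :=
  if ds is r :: ds' then expand l (s 0) r (tower l (shift s) ds' P)
  else toep_hole l s P.

(** The shift to [i.+1] keeps the junk value [toep s 0] out of all factors. *)
Definition occurs (s : nat -> bool) (n : nat) (q : nat -> bool) : Prop :=
  exists i, forall j, j < n -> q j = toep s (i.+1 + j).

Definition digits (k : nat) (ds : seq nat) : bool := (size ds == k) && all (ltn^~ 3) ds.

Arguments digits : simpl never.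

Lemma digits_cons k r ds : digits k.+1 (r :: ds) = (r < 3) && digits k ds.
Proof. by rewrite /digits /= eqSS andbCA. Qed.

(* The number of j < n with j = r mod 3, for r < 3. *)
Definition holes (n r : nat) : nat := (n + 2 - r) %/ 3.

Lemma toep_mul3 s m : 0 < m -> toep s (3 * m) = toep (shift s) m.
Proof.
move=> m0; rewrite /toep /shift lognM // logn_prime // eqxx /= add1n expnS.
by rewrite divnMl.
Qed.

Lemma toep_nmul3 s n : n %% 3 != 0 -> toep s n = s 0 (+) (n %% 3 == 1).
Proof.
move=> n3; rewrite /toep (_ : logn 3 n = 0) ?expn0 ?divn1 //.
by apply/eqP; rewrite lognE /dvdn (negPf n3) !andbF.
Qed.

Definition compl (s : nat -> bool) : nat -> bool := fun k => ~~ s k.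

Lemma toep_compl s n : toep (compl s) n = ~~ toep s n.
Proof. by rewrite /toep /compl addNb. Qed.

Local Opaque toep.

(** * One level of the Toeplitz construction *)

Section Expand.
Variables (T : Type) (l : bool -> T).

Lemma eq_expand b r n q q' : (forall m, m < holes n r -> q m = q' m) ->
  forall j, j < n -> expand l b r q j = expand l b r q' j.
Proof.
move=> qq' j jn; rewrite /expand; case: eqP => // jr; apply: qq'.
by rewrite /holes; lia.
Qed.

Lemma expand_hole b r q m : r < 3 -> expand l b r q (3 * m + r) = q m.
Proof.
move=> r3; rewrite /expand (_ : (3 * m + r) %% 3 == r); last by lia.
by congr q; lia.
Qed.

Lemma toep_hole_expand s P : toep_hole l s P =1 expand l (s 0) 0 (toep_hole l (shift s) P).
Proof.
move=> j; rewrite /toep_hole /expand; case: (j =P 0) => [->//|j0].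
case: eqP => j3.
  rewrite (_ : j %/ 3 == 0 = false); last by lia.
  have {1}-> : j = 3 * (j %/ 3) by lia.
  by rewrite toep_mul3; [|lia].
by rewrite toep_nmul3 ?muln0 ?addn0 //; apply/eqP.
Qed.

(** The holes of [toep s] are the multiples of 3, and [i + j] is one exactly when [j] is [-i], that
    is [2 * i], mod 3. *)
Lemma toep_expand s i j : let r := (2 * i) %% 3 in 0 < i ->
  toep s (i + j) = expand id (s 0) r (fun m => toep (shift s) ((i + r) %/ 3 + m)) j.
Proof.
move=> r i0; rewrite /expand; case: eqP => jr.
  rewrite -toep_mul3; last by lia.
  by congr toep; lia.
rewrite toep_nmul3; last by apply/eqP; lia.
by congr (_ (+) (_ == _)); lia.
Qed.

(** [toep] itself has hole class 0, so levels can be added until a tower is as deep as a given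
    length requires. *)
Lemma tower_cat_nseq0 s ds P k : tower l s (ds ++ nseq k 0) P =1 tower l s ds P.
Proof.
elim: ds s => [|r ds IH] s j /=; last by rewrite /expand; case: ifP => // _; rewrite IH.
elim: k s j => // k IH s j; rewrite /= toep_hole_expand.
by rewrite /expand; case: ifP => // _; rewrite IH.
Qed.

Hypothesis l_inj : l true <> l false.

(** If [r] and [r'] differed, the third class would be a hole for neither; it comes one step after
    one of them and two steps after the other, so it would carry both letters. *)
Lemma expand_phase b r r' q q' : r < 3 -> r' < 3 ->
  (forall j, j < 3 -> expand l b r q j = expand l b r' q' j) -> r = r'.
Proof.
have n1 : l b <> l (~~ b) by case: b => // /esym.
have n2 : l (~~ b) <> l b by case: b {n1} => // /esym.
move=> r3 r'3 E; have := (E 0 isT, E 1 isT, E 2 isT).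
case: r r3 {E} => [|[|[|//]]] _; case: r' r'3 => [|[|[|//]]] _ //;
  rewrite /expand /= ?addbT ?addbF; intuition congruence.
Qed.

(** The first three positions give the first class by [expand_phase]; its holes carry a tower with
    one level less, on a third of the positions. *)
Lemma tower_inj s k ds ds' P P' : digits k ds -> digits k ds' ->
  (forall j, j < 3 ^ k -> tower l s ds P j = tower l s ds' P' j) ->
  ds = ds' /\ P = P'.
Proof.
elim: k s ds ds' => [|k IH] s [|r ds] [|r' ds'] //.
  by move=> _ _ /(_ 0 isT).
case/andP=> /= /eqP[dsk] /andP[r3 dsv] /andP[/= /eqP[ds'k] /andP[r'3 ds'v]] E.
have rr : r = r'.
  apply: (@expand_phase (s 0) r r') => // j j3; apply: E.
  by rewrite expnS; have := expn_gt0 3 k; lia.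
subst r'; case: (IH (shift s) ds ds') => [||j jk|-> ->] //.
- by rewrite /digits dsk eqxx.
- by rewrite /digits ds'k eqxx.
have := E (3 * j + r); rewrite !expand_hole //; apply.
by rewrite expnS; lia.
Qed.

End Expand.

(** * Factors as truncated towers, and their recurrence *)

Lemma occurs_expand s n q : occurs s n q ->
  exists r q', [/\ r < 3, occurs (shift s) (holes n r) q' &
    forall j, j < n -> q j = expand id (s 0) r q' j].
Proof.
case=> i qi; pose r := (2 * i.+1) %% 3; pose q' m := toep (shift s) ((i.+1 + r) %/ 3 + m).
exists r, q'; split=> [|| j jn]; first by rewrite /r; lia.
  exists ((i.+1 + r) %/ 3).-1 => m _; rewrite /q'; congr toep; rewrite /r; lia.
by rewrite qi // toep_expand.
Qed.

Lemma expand_occurs s n r q : r < 3 -> occurs (shift s) (holes n r) q ->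
  occurs s n (expand id (s 0) r q).
Proof.
(* The first hole, at position [r], falls on the index [3 * i.+1]; the predecessor undoes the [.+1]
   in [occurs]. *)
move=> r3 [i qi]; exists (3 * i.+1 - r).-1 => j jn.
have i0 : 0 < (3 * i.+1 - r).-1.+1 by [].
rewrite toep_expand // (_ : (2 * _) %% 3 = r); last by lia.
rewrite (_ : (_ + r) %/ 3 = i.+1); last by lia.
by apply: eq_expand jn => m; exact: qi.
Qed.

Lemma eq_occurs s n q q' : (forall j, j < n -> q j = q' j) -> occurs s n q -> occurs s n q'.
Proof. by move=> qq [i qi]; exists i => j jn; rewrite -qq ?qi. Qed.

Lemma occurs_drop s i n q : occurs s (i + n) q -> occurs s n (fun j => q (i + j)).
Proof.
case=> h qh; exists (h + i) => j jn; rewrite qh; last by rewrite ltn_add2l.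
by congr toep; lia.
Qed.

Lemma occurs_le s m n q : m <= n -> occurs s n q -> occurs s m q.
Proof. by move=> mn [i qi]; exists i => j jm; apply: qi; lia. Qed.

(** Each level divides the length by 3, so after [k] levels at most one position is left, and its
    letter serves as [P]. *)
Lemma occurs_tower s n k q : occurs s n q -> n <= 3 ^ k ->
  exists ds P, digits k ds /\ forall j, j < n -> q j = tower id s ds P j.
Proof.
elim: k s n q => [|k IH] s n q sq nk.
  by exists [::], (q 0); split=> // -[|j] jn //; lia.
case: (occurs_expand sq) => r [q' [r3 sq' qE]].
have [|ds [P [/andP[/eqP dsk dsv] q'E]]] := IH _ _ _ sq'.
  by move: nk; rewrite expnS /holes; lia.
exists (r :: ds), P; split=> [|j jn]; first by rewrite /digits /= dsk eqxx r3.
by rewrite qE //=; exact: eq_expand jn.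
Qed.

(** A gap bound [N] for the hole word yields [3 * N + 8] one level up. In the base case a single
    letter is sought, and the non-hole classes carry both letters in every block of three. *)
Lemma tower_recurrent s ds P : all (ltn^~ 3) ds -> exists N, forall i, exists i',
  [/\ i <= i', i' <= i + N & forall j, j < 3 ^ size ds ->
    tower id s ds P j = toep s (i'.+1 + j)].
Proof.
elim: ds s => [|r ds IH] s /=.
  move=> _; exists 4 => i.
  (* The index [i'.+1] becomes 1 or 2 mod 3, where [toep] has the letter [~~ s 0] or [s 0]
     respectively. *)
  exists (3 * (i %/ 3).+1 + (if s 0 (+) P then 0 else 1)); split.
  - by lia.
  - by case: (_ (+) _); lia.
  case=> [_|//]; rewrite /toep_hole /= toep_nmul3; last by apply/eqP; case: (_ (+) _); lia.
  case E: (s 0 (+) P).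
    by rewrite (_ : _ == 1) ?addbT; [case: (s 0) P E => [] []|lia].
  by rewrite (_ : _ == 1 = false) ?addbF; [case: (s 0) P E => [] []|lia].
case/andP=> r3 dsv; have [N NP] := IH (shift s) dsv.
exists (3 * N + 8) => i; have [i' [ii' i'N i'E]] := NP (i %/ 3).+2.
exists (3 * i'.+1 - r).-1; split; [lia|lia|].
move=> j jk; rewrite toep_expand // (_ : (2 * _) %% 3 = r); last by lia.
rewrite (_ : (_ + r) %/ 3 = i'.+1); last by lia.
apply: eq_expand (jk) => m mn; apply: i'E.
by move: mn; rewrite /holes expnS; lia.
Qed.

Lemma tower_occurs s n ds P : all (ltn^~ 3) ds -> occurs s n (tower id s ds P).
Proof.
(* Appending [n] classes 0 makes the tower long enough, since [n < 3 ^ n]. *)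
move=> dsv; have : all (ltn^~ 3) (ds ++ nseq n 0) by rewrite all_cat dsv; elim: n.
case/(@tower_recurrent s _ P) => N /(_ 0) [i [_ _ iE]]; exists i => j jn.
rewrite -(tower_cat_nseq0 _ _ _ _ n) iE // size_cat size_nseq.
apply: (leq_trans jn); apply: (leq_trans (ltnW (ltn_expl n (isT : 1 < 3)))).
by rewrite leq_exp2l // leq_addl.
Qed.

Lemma occurs_recurrent s n q : occurs s n q -> exists N, forall i, exists i',
  [/\ i <= i', i' + n <= i + N & forall j, j < n -> q j = toep s (i'.+1 + j)].
Proof.
move=> sq; have [ds [P [/andP[/eqP dsn dsv] qE]]] :=
  occurs_tower sq (ltnW (ltn_expl n (isT : 1 < 3))).
have [N NP] := tower_recurrent s P dsv; exists (N + n) => i.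
have [i' [ii' i'N i'E]] := NP i; exists i'; split=> [||j jn]; [lia|lia|].
rewrite qE // i'E // dsn; exact: ltn_trans jn (ltn_expl n (isT : 1 < 3)).
Qed.

(** * Recovering the sequence from its factors *)

Lemma holes_gt0 n r : r < 3 -> 2 < n -> 0 < holes n r.
Proof. by rewrite /holes; lia. Qed.

(** Three consecutive positions meet both non-hole classes, whose letters differ. *)
Lemma occurs_aaa s q : occurs s 3 q -> ~ (q 0 = q 1 /\ q 1 = q 2).
Proof.
case/occurs_expand=> r [q' [r3 _ E]]; rewrite !E //.
by case: r r3 {E} => [|[|[|//]]] _; rewrite /expand /=; case: (s 0); case: (q' 0) => -[].
Qed.

Lemma occurs_id s i n : occurs s n (fun j => toep s (i.+1 + j)).
Proof. by exists i. Qed.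

(* Both letters of the hole sequence show which residue class carries it, and the
   other two classes then show [s 0]. *)
Lemma occurs_sub s t : (forall n q, occurs s n q -> occurs t n q) ->
  s 0 = t 0 /\ forall n q, occurs (shift s) n q -> occurs (shift t) n q.
Proof.
move=> st; suff main n q : occurs (shift s) n q -> s 0 = t 0 /\ occurs (shift t) n q.
  split=> [|n q /main[]//]; exact: (main 0 _ (occurs_id _ 0 0)).1.
case=> i qi; pose q1 m := toep (shift s) (i.+1 + m).
have sq1 : occurs s (3 * (n + 4)) (expand id (s 0) 0 q1).
  by apply: expand_occurs => //; apply: occurs_id.
have [r [q2 [r3 tq2 E]]] := occurs_expand (st _ _ sq1).
have q1P c : q1 0 = c -> q1 1 = c -> q1 2 = c -> False.
  move=> c0 c1 c2; case: (@occurs_aaa (shift s) q1); first exact: occurs_id.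
  by rewrite c0 c1 c2.
have E0 := E 0; have E3 := E 3; have E6 := E 6; have E1 := E 1; have E2 := E 2.
case: r r3 tq2 E E0 E1 E2 E3 E6 => [|[|[|//]]] _; rewrite /expand /=.
- move=> tq2 E _ E1 _ _ _; split.
    by have := E1; rewrite !addbT => /(_ _)/negb_inj; apply; lia.
  apply: (@eq_occurs _ _ q2) => [m mn|]; last by apply: occurs_le tq2; rewrite /holes; lia.
  rewrite qi // -/(q1 m); have := E (3 * m).
  by rewrite modnMr mulKn // eqxx => ->; [|lia].
(* Here and in the next case positions 0, 3 and 6 are no holes for [t], so three consecutive letters
   of [q1] would be equal. *)
- move=> _ _ E0 _ _ E3 E6.
  by case: (@q1P (t 0 (+) false)); [apply: E0|apply: E3|apply: E6]; lia.
- move=> _ _ E0 _ _ E3 E6.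
  by case: (@q1P (t 0 (+) true)); [apply: E0|apply: E3|apply: E6]; lia.
Qed.

Lemma occurs_sub_eq s t : (forall n q, occurs s n q -> occurs t n q) -> s =1 t.
Proof.
move=> st k; elim: k s t st => [|k IH] s t /occurs_sub[s0 st] //.
exact: IH st.
Qed.

(** Complementing [s] complements [toep s], which reduces the exchange of letters to an inclusion of
    factors. *)
Lemma occurs_sub_swap s t : (forall n q, occurs s n q -> occurs t n (fun j => ~~ q j)) ->
  forall k, t k = ~~ s k.
Proof.
move=> st k; rewrite -/(compl s k); apply/esym/occurs_sub_eq => n q [i qi].
apply: (@eq_occurs _ _ (fun j => ~~ ~~ q j)) => [j|]; first by rewrite negbK.
by apply: st; exists i => j jn; rewrite qi // toep_compl negbK.
Qed.

(** * Counting factors *)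

Definition words_of s n (ws : seq (seq bool)) : Prop :=
  uniq ws /\ forall w, w \in ws <-> size w = n /\ occurs s n (nth false w).

Lemma occurs2 s q : occurs s 2 q.
Proof.
have occ1 t c : occurs t 1 (fun=> c).
  by apply: eq_occurs (@tower_occurs t 1 [::] c isT) => -[].
(* The class after the hole carries [~~ s 0], the next one [s 0]. With this [r] the non-hole
   positions among 0 and 1 get their letters, and a hole there gets [c]. *)
pose r := if q 0 == s 0 then 1 else if q 1 == s 0 then 2 else 0.
pose c := if q 0 == s 0 then q 1 else q 0.
have r3 : r < 3 by rewrite /r; case: ifP => _ //; case: ifP.
apply: (@eq_occurs _ _ (expand id (s 0) r (fun=> c))).
  rewrite /expand /r /c => -[|[|//]] _ /=;
    by case: (q 0) (q 1) (s 0) => [] [] [].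
by apply: expand_occurs => //; apply: occurs_le (occ1 _ _); rewrite /holes; lia.
Qed.

Definition expand_word b r n (v : seq bool) : seq bool :=
  mkseq (expand id b r (nth false v)) n.

Lemma nth_expand_word b r n v j : j < n ->
  nth false (expand_word b r n v) j = expand id b r (nth false v) j.
Proof. exact: nth_mkseq. Qed.

(** A word of class [r] is determined by its hole word, and the three lists are disjoint since the
    first three letters show the class. *)
Lemma words_of_expand s n (ws : nat -> seq (seq bool)) : 2 < n ->
  (forall r, r < 3 -> words_of (shift s) (holes n r) (ws r)) ->
  words_of s n ([seq expand_word (s 0) 0 n v | v <- ws 0] ++
    [seq expand_word (s 0) 1 n v | v <- ws 1] ++ [seq expand_word (s 0) 2 n v | v <- ws 2]).
Proof.
move=> n3 wsP.
have phase r r' v v' : r < 3 -> r' < 3 ->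
    expand_word (s 0) r n v = expand_word (s 0) r' n v' -> r = r'.
  move=> r3 r'3 E.
  apply: (@expand_phase bool id _ (s 0) r r' (nth false v) (nth false v')) => //.
  by move=> j j3; rewrite -!(@nth_expand_word _ _ n) ?E //; lia.
split.
  have disj r r' : r < 3 -> r' < 3 -> r != r' ->
      ~~ has (mem [seq expand_word (s 0) r n v | v <- ws r])
             [seq expand_word (s 0) r' n v | v <- ws r'].
    move=> r3 r'3 /eqP rr'; apply/hasPn => _ /mapP[v' _ ->].
    apply/negP => /mapP[v _ /esym/phase].
    by move/(_ r3 r'3)/rr'.
  have un r : r < 3 -> uniq [seq expand_word (s 0) r n v | v <- ws r].
    move=> r3; have [uws wsE] := wsP r r3; rewrite map_inj_in_uniq //.
    move=> v v' /wsE[vs _] /wsE[v's _] E; apply: (@eq_from_nth _ false); first by rewrite vs.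
    rewrite vs => m mn; have := congr1 (nth false ^~ (3 * m + r)) E.
    by rewrite !nth_expand_word ?expand_hole //; move: mn; rewrite /holes; lia.
  by rewrite !cat_uniq !un // has_cat negb_or !disj.
move=> w; rewrite !mem_cat; split.
  have mem r v : r < 3 -> v \in ws r -> size (expand_word (s 0) r n v) = n /\
      occurs s n (nth false (expand_word (s 0) r n v)).
    move=> r3 /((wsP r r3).2 v).1[_ sv]; rewrite size_mkseq; split=> //.
    by apply: eq_occurs (expand_occurs r3 sv) => j jn; rewrite nth_expand_word.
  by case/or3P=> /mapP[v vws ->]; apply: mem vws.
case=> wn /occurs_expand[r [q [r3 sq E]]].
have: w \in [seq expand_word (s 0) r n v | v <- ws r].
  apply/mapP; exists (mkseq q (holes n r)).
    apply/(wsP _ r3).2; rewrite size_mkseq; split=> //.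
    by apply: eq_occurs sq => j jn; rewrite nth_mkseq.
  apply: (@eq_from_nth _ false); first by rewrite size_mkseq.
  rewrite wn => j jn; rewrite nth_expand_word // E //.
  by apply: eq_expand (jn) => m mn; rewrite nth_mkseq.
by case: r r3 {E sq} => [|[|[|//]]] _ ->; rewrite ?orbT.
Qed.

(** For [n > 2] the three values [holes n r] are positive, smaller than [n], and sum to [n]; up to
    length 2 all binary words occur. *)
Lemma count_words s n : exists2 ws, words_of s n ws & size ws = if n == 0 then 1 else 2 * n.
Proof.
have [N nN] := ubnP n; elim: N n s nN => // N IH n s nN.
case: (ltnP 2 n) => n3.
  have /cid2[ws0 ws0P c0] : exists2 ws, words_of (shift s) (holes n 0) ws &
      size ws = if holes n 0 == 0 then 1 else 2 * holes n 0.
    by apply: IH; rewrite /holes; lia.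
  have /cid2[ws1 ws1P c1] : exists2 ws, words_of (shift s) (holes n 1) ws &
      size ws = if holes n 1 == 0 then 1 else 2 * holes n 1.
    by apply: IH; rewrite /holes; lia.
  have /cid2[ws2 ws2P c2] : exists2 ws, words_of (shift s) (holes n 2) ws &
      size ws = if holes n 2 == 0 then 1 else 2 * holes n 2.
    by apply: IH; rewrite /holes; lia.
  exists ([seq expand_word (s 0) 0 n v | v <- ws0] ++
    [seq expand_word (s 0) 1 n v | v <- ws1] ++ [seq expand_word (s 0) 2 n v | v <- ws2]).
    pose ws r := if r == 0 then ws0 else if r == 1 then ws1 else ws2.
    apply: (@words_of_expand s n ws) => //.
    by case=> [|[|[|]]].
  rewrite !size_cat !size_map c0 c1 c2.
  rewrite !gtn_eqF ?holes_gt0 //; last by lia.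
  by rewrite /holes; lia.
have occ q : occurs s n q by apply: occurs_le (occurs2 s q).
have mem ws : (forall w, w \in ws = (size w == n)) ->
    forall w, w \in ws <-> size w = n /\ occurs s n (nth false w).
  by move=> wsE w; rewrite wsE; split=> [/eqP|[->]].
case: n n3 occ mem {nN} => [|[|[|//]]] _ occ mem.
- by exists [:: [::]] => //; split=> //; apply: mem; case=> // b w; rewrite inE.
- exists [:: [:: true]; [:: false]] => //; split=> //; apply: mem.
  by case=> [//|b [|b' w]] //; case: b.
exists [:: [:: true; true]; [:: true; false]; [:: false; true]; [:: false; false]] => //.
split=> //; apply: mem.
by case=> [//|b [|b' [|b'' w]]] //; case: b => //; case: b'.
Qed.

(** * The common hole, and the exchange of residues *)

(** The position that is a hole at every level: the classes are its base 3 digits, least significant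
    first. *)
Fixpoint hole_pos (ds : seq nat) : nat := if ds is r :: ds' then 3 * hole_pos ds' + r else 0.

Lemma hole_pos_lt k ds : digits k ds -> hole_pos ds < 3 ^ k.
Proof.
elim: k ds => [|k IH] [|r ds] // /[!digits_cons]/andP[r3 /IH] /=; rewrite expnS; lia.
Qed.

Lemma tower_hole T (l : bool -> T) s k ds P : digits k ds -> tower l s ds P (hole_pos ds) = P.
Proof.
elim: k s ds => [|k IH] s [|r ds] // /[!digits_cons]/andP[r3 dsv] /=.
by rewrite expand_hole // IH.
Qed.

Lemma tower_nhole T (l : bool -> T) s k ds P c j : digits k ds -> j != hole_pos ds ->
  tower l s ds P j = l (tower id s ds c j).
Proof.
elim: k s ds j => [|k IH] s [|r ds] j //; first by rewrite /= /toep_hole => _ /negPf ->.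
rewrite digits_cons => /andP[r3 dsv] jh /=; rewrite /expand; case: eqP => // jr.
apply: IH => //.
by move: jh; apply: contra => /eqP jh; apply/eqP => /=; lia.
Qed.

(** [2 * r %% 3] fixes 0 and exchanges 1 and 2, the classes for which position 0 carries [s 0] and
    [~~ s 0]. *)
Fixpoint flip_digits (s t : nat -> bool) (ds : seq nat) : seq nat :=
  if ds is r :: ds' then
    (if s 0 == t 0 then r else 2 * r %% 3) :: flip_digits (shift s) (shift t) ds'
  else [::].

Lemma digits_flip s t k ds : digits k ds -> digits k (flip_digits s t ds).
Proof.
elim: k s t ds => [|k IH] s t [|r ds] // /[!digits_cons]/andP[r3 dsv] /=.
apply/andP; split; [case: ifP => _; lia|exact: IH].
Qed.

Lemma flip_digitsK s t k ds : digits k ds -> flip_digits t s (flip_digits s t ds) = ds.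
Proof.
elim: k s t ds => [|k IH] s t [|r ds] // /[!digits_cons]/andP[r3 dsv] /=.
rewrite IH //; congr (_ :: _); rewrite [t 0 == _]eq_sym.
by case: (s 0 == t 0); lia.
Qed.

Section Flip.
Variables (T : Type) (l : bool -> T).
Hypothesis l_inj : l true <> l false.

(* Exchanging the residues 1 and 2 at the levels where [s] and [t] differ keeps the
   letter at position 0. *)
Lemma flip_head s t k ds P : digits k ds ->
  tower l t (flip_digits s t ds) P 0 = tower l s ds P 0.
Proof.
elim: k s t ds => [|k IH] s t [|r ds] // /[!digits_cons]/andP[r3 dsv] /=.
have {}IH : tower l (shift t) (flip_digits (shift s) (shift t) ds) P 0 =
    tower l (shift s) ds P 0.
  exact: IH.
rewrite /expand div0n mod0n !add0n.
case: r r3 => [|[|[|//]]] _; case: (s 0 =P t 0) => [->|st] //=; congr l;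
  by case: (s 0) (t 0) st => [] [].
Qed.

(** Makes recoding compatible with truncation: the deeper tower begins with the same classes, and at
    the one position left after [k] levels [flip_head] applies. *)
Lemma flip_restrict s t k k' ds ds' P P' : digits k ds -> digits k' ds' -> k <= k' ->
  (forall j, j < 3 ^ k -> tower l s ds P j = tower l s ds' P' j) ->
  forall j, j < 3 ^ k ->
    tower l t (flip_digits s t ds) P j = tower l t (flip_digits s t ds') P' j.
Proof.
elim: k k' s t ds ds' => [|k IH] k' s t [|r ds] ds' //.
  by move=> _ ds'v _ /(_ 0 isT) E -[|//] _; rewrite (flip_head _ _ _ ds'v) -E.
case: k' ds' => [|k'] [|r' ds'] //.
rewrite !digits_cons => /andP[r3 dsv] /andP[r'3 ds'v] kk' /= E.
have rr : r = r'.
  apply: (@expand_phase _ l l_inj (s 0) r r') => // j j3; apply: E.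
  by rewrite expnS; have := expn_gt0 3 k; lia.
subst r' => j jk; apply: (@eq_expand _ _ _ _ (3 ^ k.+1)) => // m mh.
have mk : m < 3 ^ k by move: mh; rewrite /holes expnS; case: ifP => _; lia.
apply: (IH k') => // i ik.
have := E (3 * i + r); rewrite !expand_hole //; apply.
by rewrite expnS; lia.
Qed.

End Flip.

(** * Words supported by a sequence of points, with an abstract support relation *)

Section Support.
Variables (T : Type) (l : bool -> T) (sup : T -> bool -> Prop).
Hypothesis sup_ex : forall p, exists c, sup p c.
Hypothesis sup_l : forall b c, sup (l b) c <-> c = b.
Hypothesis sup_uniq : forall p b, (forall c, sup p c -> c = b) -> p = l b.

(** Only the common hole can support more than one letter; the letter of [f] there serves as [c]. *)
Lemma tower_support_word s n ds P f : all (ltn^~ 3) ds ->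
  (forall j, j < n -> sup (tower l s ds P j) (f j)) ->
  exists c, forall j, j < n -> f j = tower id s ds c j.
Proof.
elim: ds s n f => [|r ds IH] s n f /=.
  move=> _ fZ; exists (f 0) => -[|j] // /fZ; rewrite /toep_hole /=.
  by move/sup_l.
case/andP=> r3 dsv fZ.
have [||c cE] := IH (shift s) (holes n r) (fun m => f (3 * m + r)) => //.
  move=> m mn; have := fZ (3 * m + r); rewrite expand_hole //; apply.
  by move: mn; rewrite /holes; lia.
exists c => j jn; rewrite /expand; have := fZ j jn; rewrite /expand; case: eqP => jr.
  have <- : 3 * (j %/ 3) + r = j by lia.
  by rewrite (_ : (3 * (j %/ 3) + r) %/ 3 = j %/ 3) ?cE // /holes; lia.
by move/sup_l.
Qed.

Lemma tower_support s n ds P f : all (ltn^~ 3) ds ->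
  (forall j, j < n -> sup (tower l s ds P j) (f j)) -> occurs s n f.
Proof.
move=> dsv fZ; have [c fE] := tower_support_word dsv fZ.
by apply: eq_occurs (tower_occurs s n c dsv) => j /fE.
Qed.

(* Two supported words can be mixed freely, and the first three letters of a word
   already determine its phase; so all supported words have the same phase. *)
Lemma support_tower s k Z :
  (forall n f, (forall j, j < n -> sup (Z j) (f j)) -> occurs s n f) ->
  exists ds P, digits k ds /\ forall j, j < 3 ^ k -> Z j = tower l s ds P j.
Proof.
elim: k s Z => [|k IH] s Z ZP.
  by exists [::], (Z 0); split=> // -[].
have [f0 f0Z] := choice (fun j => sup_ex (Z j)).
have [r [q0 [r3 _ E0]]] := occurs_expand (ZP 3 f0 (fun j _ => f0Z j)).
have phase n f : (forall j, j < n -> sup (Z j) (f j)) ->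
    exists q, occurs (shift s) (holes n r) q /\ forall j, j < n -> f j = expand id (s 0) r q j.
  (* [f] continued by [f0] has some class [r']. Replacing its first three letters by those of [f0]
     gives a class [r'']; the first three letters show [r'' = r], the next three [r'' = r']. *)
  move=> fZ; have/ZP/occurs_expand[r' [q [r'3 sq E]]] :
      forall j, j < 3 * n + 6 -> sup (Z j) (if j < n then f j else f0 j).
    by move=> j _; case: ifP => [/fZ|].
  have/ZP/occurs_expand[r'' [q' [r''3 _ E']]] :
      forall j, j < 3 * n + 6 ->
        sup (Z j) (if j < 3 then f0 j else if j < n then f j else f0 j).
    by move=> j _; case: ifP => // _; case: ifP => [/fZ|].
  have rr'' : r = r''.
    apply: (@expand_phase bool id _ (s 0) r r'' q0 q') => // j j3.
    by rewrite -E0 // -E' ?j3 //; lia.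
  have r'r'' : r' = r''.
    apply: (@expand_phase bool id _ (s 0) r' r'' (q \o S) (q' \o S)) => // j j3.
    have expS q1 r1 : expand id (s 0) r1 (q1 \o S) j = expand id (s 0) r1 q1 (j + 3).
      have e1 : (j + 3) %% 3 = j %% 3 by lia.
      have e2 : (j + 3) %/ 3 = (j %/ 3).+1 by lia.
      have e3 : (j + 3 + 2 * r1) %% 3 = (j + 2 * r1) %% 3 by lia.
      by rewrite /expand e1 e2 e3.
    rewrite !expS -E -?E' //; try lia.
    by rewrite (_ : j + 3 < 3 = false) //; lia.
  have r'r : r' = r by rewrite r'r'' -rr''.
  rewrite r'r in sq E; exists q; split.
    by apply: occurs_le sq; rewrite /holes; lia.
  by move=> j jn; rewrite -E ?jn //; lia.
have [|ds [P [/andP[/eqP dsk dsv] ZE]]] := IH (shift s) (fun m => Z (3 * m + r)).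
  move=> n f fZ.
  (* A word supported on the hole class is spread out, with [f0] on the other classes. *)
  have [|q [sq qE]] := phase (3 * n) (fun j => if j %% 3 == r then f (j %/ 3) else f0 j).
    move=> j jn; case: eqP => // jr; have -> : j = 3 * (j %/ 3) + r by lia.
    by rewrite (_ : (3 * (j %/ 3) + r) %/ 3 = j %/ 3); [apply: fZ|]; lia.
  apply: (@eq_occurs _ _ q); last by apply: occurs_le sq; rewrite /holes; lia.
  move=> m mn; have := qE (3 * m + r); rewrite expand_hole // => <-; last by lia.
  have e1 : (3 * m + r) %% 3 = r by lia.
  have e2 : (3 * m + r) %/ 3 = m by lia.
  by rewrite e1 e2 eqxx.
exists (r :: ds), P; split; first by rewrite /digits /= dsk eqxx r3.
move=> j jk /=; rewrite /expand; case: eqP => jr.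
  have -> : j = 3 * (j %/ 3) + r by lia.
  by rewrite ZE; [congr tower; lia|move: jk; rewrite expnS; lia].
(* Outside the hole class the common phase forces the letter, so only one letter is supported. *)
apply: sup_uniq => c Zc.
have [|q [_ /(_ j (ltnSn j))]] := phase j.+1 (fun i => if i == j then c else f0 i).
  by move=> i _; case: eqP => [->|].
by rewrite eqxx /expand; case: eqP.
Qed.

End Support.

Local Open Scope ring_scope.

(** * Dimension and free algebras *)

Section Dim.
Variables (F : fieldType) (M : lmodType F).
Implicit Type V : set M.

(** The coordinates of the [b i] form an [e] by [d] matrix, whose left kernel is nonzero if
    [e > d]. *)
Lemma has_dim_indep V d e (b : 'I_e -> M) : has_dim V d -> (forall i, V (b i)) ->
  (forall c : 'I_e -> F, \sum_i c i *: b i = 0 -> forall i, c i = 0) -> (e <= d)%N.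
Proof.
case=> v [_ _ vV] bV bfree; have [C CE] := choice (fun i => vV _ (bV i)).
pose A : 'M[F]_(e, d) := \matrix_(i, j) C i j.
rewrite leqNgt; apply/negP => de.
have : kermx A != 0.
  by rewrite kermx_eq0 /row_free neq_ltn (leq_ltn_trans (rank_leq_col A) de).
case/rowV0Pn=> u /sub_kermxP uA /eqP[]; apply/rowP => i; rewrite mxE.
apply: (bfree (u 0)) => //.
under eq_bigr => k _ do rewrite CE scaler_sumr.
rewrite exchange_big big1 //= => j _.
under eq_bigr => k _ do rewrite scalerA.
have uAj : \sum_k u 0 k * C k j = (u *m A) 0 j.
  by rewrite mxE; apply: eq_bigr => k _; rewrite mxE.
by rewrite -scaler_suml uAj uA mxE scale0r.
Qed.

Lemma has_dim_uniq V d e : has_dim V d -> has_dim V e -> d = e.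
Proof.
move=> Vd Ve; apply/eqP; rewrite eqn_leq.
case: (Vd) (Ve) => b [bV bf _] [b' [b'V b'f _]].
by rewrite (has_dim_indep Ve bV bf) (has_dim_indep Vd b'V b'f).
Qed.

Lemma dimensionE V d : has_dim V d -> dimension V = d.
Proof.
move=> Vd; rewrite /dimension.
have Vx : has_dim V (xget 0%N [set d | has_dim V d]) by apply: (xgetI 0%N (x := d)).
exact: has_dim_uniq Vx Vd.
Qed.

Lemma span_finite_dim n (b : 'I_n -> M) :
  (forall v, exists c : 'I_n -> F, v = \sum_i c i *: b i) -> finite_dim [set: M].
Proof.
elim: n b => [|n IH] b bspan; first by exists 0%N, b; split=> // c _ [].
have [bfree|] := pselect (forall c : 'I_n.+1 -> F, \sum_i c i *: b i = 0 -> forall i, c i = 0).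
  by exists n.+1, b; split.
move=> /existsNP[c /not_implyP[c0 /existsNP[i /eqP ci]]].
apply: (IH (fun k => b (lift i k))) => v; have [a ->] := bspan v.
have bi : b i = \sum_k (- (c i)^-1 * c (lift i k)) *: b (lift i k).
  move: c0; rewrite (bigD1_ord i) //= => /eqP; rewrite addr_eq0 => /eqP cbi.
  rewrite -[LHS]scale1r -(mulVf ci) -scalerA cbi scalerN -scaleNr scaler_sumr.
  by apply: eq_bigr => k _; rewrite scalerA.
exists (fun k => a i * (- (c i)^-1 * c (lift i k)) + a (lift i k)).
rewrite (bigD1_ord i) //= {1}bi scaler_sumr -big_split /=.
by apply: eq_bigr => k _; rewrite scalerDl scalerA.
Qed.

End Dim.

(** * Coefficients in the free algebra *)

Section FreeAlgebraTheory.
Variables (F : fieldType) (m : nat).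
Local Notation R := (free_algebra F m).
Implicit Types (p q : R) (u v w : seq 'I_m).

Definition fcoef w p : F := mcoeff (FMonom w) p.

Lemma fcoef_word u w : fcoef w (free_word F u) = (u == w)%:R.
Proof. by rewrite /fcoef /free_word mcoeffU1 fmP. Qed.

Lemma fcoefD w : {morph fcoef w : p q / p + q}. Proof. exact: mcoeffD. Qed.
Lemma fcoefB w : {morph fcoef w : p q / p - q}. Proof. exact: mcoeffB. Qed.
Lemma fcoefZ w c p : fcoef w (c *: p) = c * fcoef w p. Proof. exact: mcoeffZ. Qed.
Lemma fcoef0 w : fcoef w 0 = 0. Proof. exact: mcoeff0. Qed.

Lemma free_word_cat u v : free_word F (u ++ v) = free_word F u * free_word F v.
Proof.
by rewrite /free_word malgM_def fgmulUU mulr1; congr mkmalgU; apply/eqP; rewrite fmP fmM.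
Qed.

Lemma free_word_nil : free_word F ([::] : seq 'I_m) = 1.
Proof. by rewrite /free_word; congr mkmalgU; apply/eqP; rewrite fmP fm1. Qed.

Lemma fcoef_homog n p w : free_homog n p -> size w != n -> fcoef w p = 0.
Proof.
move=> pn /eqP wn; apply: mcoeff_outdom; apply/negP => /pn /=.
exact: wn.
Qed.

Lemma word_homog w : free_homog (size w) (free_word F w).
Proof. by move=> u; rewrite /free_word msuppU1 inE => /eqP ->. Qed.

Lemma free_algE p :
  p = \sum_(w <- msupp p) fcoef (fmonom_val w) p *: free_word F (fmonom_val w).
Proof.
rewrite {1}[p]monalgE; apply: eq_bigr => w _; apply/malgP => u.
by rewrite mcoeffZ /fcoef !mcoeffU fmK mulr_natr.
Qed.

Lemma free_alg_ind (P : R -> Prop) : P 0 -> (forall p q, P p -> P q -> P (p + q)) ->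
  (forall c w, P (c *: free_word F w)) -> forall p, P p.
Proof. by move=> P0 PD Pw p; rewrite [p]free_algE; elim/big_rec: _ => // w q _; exact: PD. Qed.

Lemma scale_free_word c d u : c *: (d *: free_word F u) = (c * d) *: free_word F u.
Proof. exact: scalerA. Qed.

Lemma mul_free_word c d u v :
  (c *: free_word F u) * (d *: free_word F v) = (c * d) *: free_word F (u ++ v).
Proof. by rewrite -scalerAl -scalerAr -free_word_cat scalerA. Qed.

Lemma fcoefM p q w :
  fcoef w (p * q) = \sum_(i < (size w).+1) fcoef (take i w) p * fcoef (drop i w) q.
Proof.
elim/free_alg_ind: p => [|p1 p2 IH1 IH2|c u].
- by rewrite mul0r fcoef0 big1 // => i _; rewrite fcoef0 mul0r.
- rewrite mulrDl. rewrite fcoefD.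
  under [RHS]eq_bigr => i _ do rewrite fcoefD mulrDl.
  by rewrite big_split; congr (_ + _); [exact: IH1|exact: IH2].
elim/free_alg_ind: q => [|q1 q2 IH1 IH2|d v].
- by rewrite mulr0 fcoef0 big1 // => i _; rewrite fcoef0 mulr0.
- rewrite mulrDr. rewrite fcoefD.
  under [RHS]eq_bigr => i _ do rewrite fcoefD mulrDr.
  by rewrite big_split; congr (_ + _); [exact: IH1|exact: IH2].
rewrite mul_free_word fcoefZ fcoef_word.
under eq_bigr => i _ do rewrite !fcoefZ !fcoef_word.
have [<-|uvw] := eqVneq (u ++ v) w.
  have ulen : (size u < (size (u ++ v)).+1)%N by rewrite size_cat ltnS leq_addr.
  rewrite (bigD1 (Ordinal ulen)) //= take_size_cat // drop_size_cat // !eqxx.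
  rewrite !mulr1 big1 ?addr0 // => i /eqP iu.
  case: eqP => [ui|]; last by rewrite mulr0 mul0r.
  case: iu; apply: val_inj => /=; move: (congr1 size ui).
  by rewrite size_takel //; exact: (leq_ord i).
rewrite big1 ?mulr0 // => i _; case: eqP => [ui|]; last by rewrite mulr0 mul0r.
case: eqP => [vi|]; last by rewrite !mulr0.
by move: uvw; rewrite ui vi cat_take_drop eqxx.
Qed.

End FreeAlgebraTheory.

(** * The monomial algebra of a factorial language *)

Definition lang_data m (L : set (seq 'I_m)) (L0 : L [::]) : monomial_data :=
  @MonomialData m [set w | ~ L w] (fun notL0 => notL0 L0).

Definition factorial_lang m (L : set (seq 'I_m)) : Prop :=
  forall u v w, L (u ++ v ++ w) -> L v.

Section LangAlgebra.
Variables (F : fieldType) (m : nat) (L : set (seq 'I_m)) (L0 : L [::]).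
Hypothesis Lfac : factorial_lang L.
Local Notation D := (lang_data L0).
Local Notation A := (monomial_algebra F D).
Local Notation R := (free_algebra F m).
Implicit Types (p q : R) (a b : A) (u v w : seq 'I_m).

(** Factors of words of [L] lie in [L], so the elements without coefficients on [L] already form a
    two-sided ideal. *)
Lemma relation_idealE p : relation_ideal (D := D) p <-> forall w, L w -> fcoef w p = 0.
Proof.
have [I0 IB IMl IMr] := relation_idealP F D.
split=> [Ip|pL].
  apply: (Ip [set x | forall w, L w -> fcoef w x = 0]).
  split=> [|_ /= [u /= nLu <-] w Lw]; last first.
    by rewrite fcoef_word; case: eqP => // uw; case: nLu; rewrite uw.
  split=> /= [w _|x y x0 y0 w Lw|x y y0 w Lw|x y y0 w Lw].
  - exact: fcoef0.
  - by rewrite fcoefB x0 // y0 // subrr.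
  - rewrite fcoefM big1 // => i _; rewrite (y0 (drop i w)) ?mulr0 //.
    by apply: (Lfac (u := take i w) (w := [::])); rewrite cats0 cat_take_drop.
  - rewrite fcoefM big1 // => i _; rewrite (y0 (take i w)) ?mul0r //.
    by apply: (Lfac (u := [::]) (w := drop i w)); rewrite /= cat_take_drop.
rewrite (free_algE p).
have ID (x y : R) : @relation_ideal F D x -> @relation_ideal F D y ->
    @relation_ideal F D (x + y).
  by move=> Ix Iy; have := IB _ _ Ix (IB _ _ I0 Iy); rewrite sub0r opprK.
elim/big_rec: _ => // w x _ Ix; apply: ID => //.
have [Lw|nLw] := pselect (L (fmonom_val w)); first by rewrite pL // scale0r.
rewrite -mulr_algl; apply: (IMl) => J [_ JW]; apply: JW.
by exists (fmonom_val w).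
Qed.

Definition cls p : A := to_monomial (D := D) p.
Definition mword w : A := cls (free_word F w).
(** Read on a chosen representative; it depends on the class alone for words of [L], hence the
    hypothesis [L w] in what follows. *)
Definition acoef w a : F := fcoef w (repr a).

Lemma clsD : {morph cls : p q / p + q}. Proof. exact: quotient_piD. Qed.
Lemma clsM : {morph cls : p q / p * q}. Proof. exact: quotient_piM. Qed.
Lemma clsZ c : {morph cls : p / c *: p}. Proof. exact: quotient_piZ. Qed.
Lemma cls0 : cls 0 = 0. Proof. exact: quotient_pi0. Qed.
Lemma cls1 : cls 1 = 1. Proof. by rewrite /cls /to_monomial -quotient_pi1. Qed.
Lemma cls_repr a : cls (repr a) = a. Proof. exact: reprK. Qed.

Lemma cls_eqP p q : cls p = cls q <-> forall w, L w -> fcoef w p = fcoef w q.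
Proof.
split=> [/quotient_eqP|pq]; last apply/quotient_eqP.
  rewrite ideal2E => /asboolP/relation_idealE pq w /pq/eqP.
  by rewrite fcoefB subr_eq0 => /eqP.
rewrite ideal2E; apply/asboolP/relation_idealE => w /pq.
by rewrite fcoefB => ->; rewrite subrr.
Qed.

Lemma acoef_cls p w : L w -> acoef w (cls p) = fcoef w p.
Proof.
have /cls_eqP E : cls (repr (cls p)) = cls p by rewrite cls_repr.
exact: E.
Qed.

Lemma acoefP a b : (forall w, L w -> acoef w a = acoef w b) -> a = b.
Proof.
move=> ab; rewrite -[a]cls_repr -[b]cls_repr; apply/cls_eqP; exact: ab.
Qed.

Lemma acoefD w a b : L w -> acoef w (a + b) = acoef w a + acoef w b.
Proof. by move=> Lw; rewrite -{1}[a]cls_repr -{1}[b]cls_repr -clsD acoef_cls // fcoefD. Qed.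

Lemma acoefZ w c a : L w -> acoef w (c *: a) = c * acoef w a.
Proof. by move=> Lw; rewrite -{1}[a]cls_repr -clsZ acoef_cls // fcoefZ. Qed.

Lemma acoef0 w : L w -> acoef w 0 = 0.
Proof. by move=> Lw; rewrite -cls0 acoef_cls // fcoef0. Qed.

Lemma acoef_sum w I (r : seq I) (P : pred I) (f : I -> A) : L w ->
  acoef w (\sum_(i <- r | P i) f i) = \sum_(i <- r | P i) acoef w (f i).
Proof.
move=> Lw; elim/big_rec2: _ => [|i x y _ <-]; first exact: acoef0.
exact: acoefD.
Qed.

Lemma acoefM w a b : L w ->
  acoef w (a * b) = \sum_(i < (size w).+1) acoef (take i w) a * acoef (drop i w) b.
Proof.
by move=> Lw; rewrite -{1}[a]cls_repr -{1}[b]cls_repr -clsM acoef_cls // fcoefM.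
Qed.

Lemma acoef_mword w u : L w -> acoef w (mword u) = (u == w)%:R.
Proof. by move=> Lw; rewrite acoef_cls // fcoef_word. Qed.

Lemma mword_eq0 w : ~ L w -> mword w = 0.
Proof.
move=> nLw; apply: acoefP => u Lu; rewrite acoef_mword // acoef0 //.
by case: eqP => // wu; case: nLw; rewrite wu.
Qed.

Lemma mword_cat u v : mword (u ++ v) = mword u * mword v.
Proof. by rewrite /mword free_word_cat clsM. Qed.

Lemma mword_nil : mword [::] = 1.
Proof. by rewrite /mword free_word_nil cls1. Qed.

Lemma algE a : a = \sum_(w <- msupp (repr a)) acoef (fmonom_val w) a *: mword (fmonom_val w).
Proof.
rewrite -{1}[a]cls_repr {1}[repr a]free_algE.
elim/big_rec2: _ => [|w x y _ <-]; first exact: cls0.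
by rewrite clsD clsZ.
Qed.

Lemma alg_ind (P : A -> Prop) : P 0 -> (forall a b, P a -> P b -> P (a + b)) ->
  (forall c w, P (c *: mword w)) -> forall a, P a.
Proof. by move=> P0 PD Pw a; rewrite [a]algE; elim/big_rec: _ => // w b _; exact: PD. Qed.

Lemma mword_homog w : mon_homog (D := D) (size w) (mword w).
Proof. by exists (free_word F w) => //; exact: word_homog. Qed.

Lemma acoef_homog n a w : mon_homog (D := D) n a -> L w -> size w != n -> acoef w a = 0.
Proof. by case=> p pn <- Lw wn; rewrite acoef_cls // (fcoef_homog pn). Qed.

Lemma mon_homog0 n : mon_homog (D := D) n (0 : A).
Proof. by exists 0; [move=> w; rewrite msupp0 inE|exact: cls0]. Qed.

Lemma has_dim_words (V : set A) (ws : seq (seq 'I_m)) : uniq ws ->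
  (forall w, w \in ws -> L w /\ V (mword w)) ->
  (forall a w, V a -> L w -> w \notin ws -> acoef w a = 0) -> has_dim V (size ws).
Proof.
move=> uws wsP VP; exists (fun i => mword (nth [::] ws i)).
have wsL (i : 'I_(size ws)) : L (nth [::] ws i) by apply: (wsP _ _).1; exact: mem_nth.
have acoef_lin (c : 'I_(size ws) -> F) (j : 'I_(size ws)) :
    acoef (nth [::] ws j) (\sum_i c i *: mword (nth [::] ws i)) = c j.
  rewrite acoef_sum // (bigD1 j) //= acoefZ // acoef_mword // eqxx mulr1.
  rewrite big1 ?addr0 // => i ij.
  by rewrite acoefZ // acoef_mword // nth_uniq // -val_eqE in ij *; rewrite (negPf ij) mulr0.
split=> [i|c c0 j|a Va]; first by apply: (wsP _ _).2; exact: mem_nth.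
  by rewrite -(acoef_lin c) c0 acoef0.
exists (fun i => acoef (nth [::] ws i) a); apply: acoefP => w Lw.
have [wws|wws] := boolP (w \in ws).
  have wi : (index w ws < size ws)%N by rewrite index_mem.
  have := acoef_lin (fun i => acoef (nth [::] ws i) a) (Ordinal wi).
  by rewrite /= nth_index // => ->.
rewrite (VP a) // acoef_sum // big1 // => i _; rewrite acoefZ // acoef_mword //.
case: eqP => [iw|]; last by rewrite mulr0.
by move: wws; rewrite -iw mem_nth.
Qed.

Lemma hilbert_seriesE n (ws : seq (seq 'I_m)) : uniq ws ->
  (forall w, w \in ws <-> L w /\ size w = n) -> hilbert_series F D n = size ws.
Proof.
move=> uws wsP; apply: dimensionE; apply: has_dim_words => // [w|a w an Lw].
  by move=> /wsP[Lw <-]; split=> //; exact: mword_homog.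
by move/negP => wws; apply: (acoef_homog an) => //; apply/eqP => wn; case: wws; apply/wsP.
Qed.

Lemma growth_functionE n (ws : seq (seq 'I_m)) : uniq ws ->
  (forall w, w \in ws <-> L w /\ (size w <= n)%N) -> growth_function F D n = size ws.
Proof.
move=> uws wsP; apply: dimensionE; apply: has_dim_words => // [w|a w].
  move=> /wsP[Lw wn]; split=> //; exists (fun i => if i == size w then mword w else 0).
  split=> [i|]; first by case: eqP => [->|_]; [exact: mword_homog|exact: mon_homog0].
  rewrite (bigD1 (Ordinal (wn : (size w < n.+1)%N))) //= eqxx big1 ?addr0 // => i.
  by rewrite -val_eqE => /negPf /= ->.
move=> [b [bh ->]] Lw /negP wws; rewrite acoef_sum // big1 // => i _.
apply: (acoef_homog (bh i)) => //; apply/eqP => wi; case: wws; apply/wsP.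
by split=> //; rewrite wi -ltnS.
Qed.

End LangAlgebra.

(** * Projective simplicity *)

Section Code.
Variable m : nat.
Implicit Types u v w : seq 'I_m.
Local Open Scope nat_scope.

(* The value of a word in base m orders words of the same length lexicographically. *)
Fixpoint code w : nat := if w is a :: w' then a * m ^ size w' + code w' else 0.

Lemma code_lt w : code w < m ^ size w.
Proof.
elim: w => //= a w IH; rewrite expnS.
apply: (@leq_trans (a.+1 * m ^ size w)); first by rewrite mulSn addnC ltn_add2r.
by rewrite leq_mul2r ltn_ord orbT.
Qed.

Lemma code_inj u v : size u = size v -> code u = code v -> u = v.
Proof.
elim: u v => [|a u IH] [|b v] //= [uv]; rewrite uv => E.
have m0 : 0 < m ^ size v by rewrite (leq_ltn_trans _ (code_lt v)).
have cu : code u < m ^ size v by rewrite -uv code_lt.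
have ab : a = b.
  by apply: val_inj; have := congr1 (divn ^~ (m ^ size v)) E;
    rewrite !divnMDl // !divn_small ?code_lt // !addn0.
by move: E; rewrite ab => /addnI/IH ->.
Qed.

Lemma code_cat u v : code (u ++ v) = code u * m ^ size v + code v.
Proof.
by elim: u => //= a u ->; rewrite size_cat expnD mulnDl addnA mulnA.
Qed.

Lemma code_lt_cat u s w v : size s = size w -> code s < code w ->
  code (u ++ s ++ v) < code (u ++ w ++ v).
Proof.
move=> sw lt; rewrite !code_cat !size_cat sw ltn_add2l ltn_add2r ltn_pmul2r //.
by rewrite (leq_ltn_trans _ (code_lt v)).
Qed.

Definition words_upto n : seq (seq 'I_m) :=
  flatten [seq [seq tval t | t <- enum {: k.-tuple 'I_m}] | k <- iota 0 n].

Lemma mem_words_upto n w : (w \in words_upto n) = (size w < n).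
Proof.
apply/flatten_mapP/idP => [[k]|wn].
  by rewrite mem_iota => kn /mapP[t _ ->]; rewrite size_tuple.
exists (size w); first by rewrite mem_iota.
by apply/mapP; exists (in_tuple w); rewrite ?mem_enum.
Qed.

End Code.

Section ProjectivelySimple.
Variables (F : fieldType) (m : nat) (L : set (seq 'I_m)) (L0 : L [::]).
Hypothesis Lfac : factorial_lang L.
Hypothesis Linf : forall n, exists2 w, L w & size w = n.
Hypothesis Lrec : forall w, L w ->
  exists N, forall z, L z -> (N <= size z)%N -> exists u v, z = u ++ w ++ v.
Local Notation D := (lang_data L0).
Local Notation A := (monomial_algebra F D).
Local Notation mword := (mword F L0).

Lemma lang_infinite_dim : ~ finite_dim [set: A].
Proof.
case=> d Ad; have /choice[w /all_and2[wL wn]] n : exists w, L w /\ size w = n.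
  by have [w Lw wn] := Linf n; exists w.
suff : (d.+1 <= d)%N by rewrite ltnn.
apply: (has_dim_indep Ad (b := fun i : 'I_d.+1 => mword (w i))) => // c c0 i.
have := acoef0 F L0 Lfac (wL i); rewrite -c0 acoef_sum // (bigD1 i) //= acoefZ //.
rewrite acoef_mword // eqxx mulr1.
rewrite big1 ?addr0 // => j ij; rewrite acoefZ // acoef_mword //.
case: eqP => [/(congr1 size)|]; last by rewrite mulr0.
by rewrite !wn => ji; move: ij; rewrite -val_eqE /= ji eqxx.
Qed.

(* Multiplying so that the lexicographically largest word of f lands inside the
   lexicographically smallest word of its length in L kills all other words of f. *)
Lemma homog_ideal_mword (J : proper_ideal2 A) n f : mon_homog (D := D) n f ->
  ideal2_set J f -> f != 0 -> exists2 z, L z & ideal2_set J (mword z).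
Proof.
have [_ _ JMl JMr] := ideal2P J.
move=> fn Jf f0.
have [w0 [w0L w0f]] : exists w, L w /\ acoef w f != 0.
  apply: contrapT => /forallNP fw; case/eqP: f0; apply: (acoefP Lfac) => w Lw.
  rewrite acoef0 //; apply/eqP/negPn/negP => wf; exact: (fw w).
have sf w : L w -> acoef w f != 0 -> size w = n.
  by move=> Lw; apply: contraNeq => /(acoef_homog Lfac fn Lw) ->.
pose S c := `[< exists w, [/\ L w, acoef w f != 0 & code w = c] >].
have Sex : exists c, S c by exists (code w0); apply/asboolP; exists w0.
have Sbd c : S c -> (c <= m ^ n)%N.
  by move/asboolP=> [w [Lw wf <-]]; rewrite -(sf w Lw wf) ltnW // code_lt.
case: (ex_maxnP Sex Sbd) => c /asboolP[w [Lw wf wc]] cmax.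
have [N NP] := Lrec Lw; have [z0 z0L z0N] := Linf N.
pose T c := `[< exists z, [/\ L z, size z = N & code z = c] >].
have Tex : exists c, T c by exists (code z0); apply/asboolP; exists z0.
case: (ex_minnP Tex) => d /asboolP[z [Lz zN zd]] dmin.
have [|u [v zE]] := NP z Lz; first by rewrite zN.
exists z => //.
have -> : mword z = (acoef w f)^-1 *: (mword u * f * mword v).
  rewrite {2}[f]algE mulr_sumr mulr_suml.
  rewrite (bigD1_seq (FMonom w)) /=; last exact: fset_uniq; last by rewrite -mcoeff_neq0.
  rewrite big1 ?addr0 => [|s sw].
    by rewrite -scalerAr -scalerAl scalerA mulVf // scale1r -!mword_cat -catA -zE.
  rewrite -scalerAr -scalerAl -!mword_cat -catA.
  have [->|sf0] := eqVneq (acoef (fmonom_val s) f) 0; first by rewrite scale0r.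
  (* For another word [s] of [f], the word [u s v] would have length [N] and a code below that of
     [z], which is minimal in [L]. *)
  rewrite (mword_eq0 F L0 Lfac) ?scaler0 // => Lusv.
  have Ls : L (fmonom_val s) := Lfac Lusv.
  have sz : size (fmonom_val s) = size w by rewrite !sf.
  have : (d <= code (u ++ fmonom_val s ++ v))%N.
    apply: dmin; apply/asboolP; exists (u ++ fmonom_val s ++ v); split=> //.
    by rewrite -zN zE !size_cat sz.
  rewrite -zd zE leqNgt => /negP[]; apply: code_lt_cat => //.
  rewrite wc ltn_neqAle cmax ?andbT; last by apply/asboolP; exists (fmonom_val s).
  apply: contra sw => /eqP sc; apply/eqP; rewrite -[s]fmK; congr FMonom.
  by apply: code_inj => //; rewrite sc.
rewrite -mulr_algl; apply: (JMl); apply: (JMr); exact: (JMl).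
Qed.

(** Words of [L] of length at least [N] contain [z] and become 0, so the shorter words span the
    quotient. *)
Lemma quotient_finite_dim (J : proper_ideal2 A) z : L z -> ideal2_set J (mword z) ->
  finite_dim [set: quotient_algebra J].
Proof.
have [_ _ JMl JMr] := ideal2P J.
move=> Lz Jz; have [N NP] := Lrec Lz.
pose ws := words_upto m N; pose Q := quotient_algebra J.
pose b (i : 'I_(size ws)) : Q := \pi_Q (mword (nth [::] ws i)).
suff span a : exists c : 'I_(size ws) -> F, \pi_Q a = \sum_i c i *: b i.
  by apply: (span_finite_dim (b := b)) => x; rewrite -[x]reprK; exact: span.
elim/alg_ind: a => [|a a' [c ca] [c' ca']|c w].
- exists (fun=> 0); rewrite quotient_pi0 big1 // => i _; exact: scale0r.
- exists (fun i => c i + c' i).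
  under eq_bigr do rewrite scalerDl.
  by rewrite quotient_piD ca ca' big_split.
have [wws|] := boolP (w \in ws).
  have wi : (index w ws < size ws)%N by rewrite index_mem.
  exists (fun i => c * (i == Ordinal wi)%:R); rewrite (bigD1 (Ordinal wi)) //= eqxx mulr1.
  rewrite big1 ?addr0 => [|i /negPf ->]; last by rewrite mulr0 scale0r.
  by rewrite /b /= nth_index // quotient_piZ.
rewrite mem_words_upto -leqNgt => wN; exists (fun=> 0).
rewrite big1 => [|i _]; last exact: scale0r.
rewrite -quotient_pi0; apply/quotient_eqP; rewrite subr0 ideal2E; apply/asboolP.
rewrite -mulr_algl; apply: (JMl).
have [Lw|nLw] := pselect (L w); last first.
  rewrite (mword_eq0 F L0 Lfac) // -(mul0r (mword z)); exact: (JMl).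
have [u [v ->]] := NP w Lw wN; rewrite !mword_cat.
by apply: (JMl); apply: (JMr).
Qed.

Lemma lang_projectively_simple : projectively_simple F D.
Proof.
split; first exact: lang_infinite_dim.
move=> J Jgr [x Jx x0]; have [N [a [aJ xE]]] := Jgr x Jx.
have [i ai0] : exists i : 'I_N, a i != 0.
  apply: contrapT => /forallNP a0; case/eqP: x0; rewrite xE big1 // => i _.
  by apply/eqP/negPn/negP; exact: a0.
have [ah Ja] := aJ i; have [z Lz Jz] := homog_ideal_mword ah Ja ai0.
exact: quotient_finite_dim Lz Jz.
Qed.

End ProjectivelySimple.

(** * Isomorphisms *)

Section Isomorphism.
Variables (F : fieldType) (m : nat) (L1 L2 : set (seq 'I_m)).
Variables (L10 : L1 [::]) (L20 : L2 [::]).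
Hypotheses (Lfac1 : factorial_lang L1) (Lfac2 : factorial_lang L2).
Hypothesis nilL1 : forall j, exists k, ~ L1 (nseq k j).
Hypothesis letL2 : forall j, L2 [:: j].
Local Notation A := (monomial_algebra F (lang_data L10)).
Local Notation B := (monomial_algebra F (lang_data L20)).
Variable f : {lrmorphism A -> B}.
Hypothesis f_surj : forall b, exists a, f a = b.
Local Notation word1 := (mword F L10).
Local Notation word2 := (mword F L20).

Lemma acoef_nilM (b c : B) : acoef [::] (b * c) = acoef [::] b * acoef [::] c.
Proof. by rewrite acoefM // big_ord_recl big_ord0 addr0. Qed.

Lemma acoef1 w : L2 w -> acoef w (1 : B) = (w == [::])%:R.
Proof. by move=> Lw; rewrite -mword_nil acoef_mword // eq_sym. Qed.

Lemma mword_nseq k j : word1 (nseq k j) = word1 [:: j] ^+ k.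
Proof. by elim: k => [|k IH]; rewrite ?mword_nil // exprS -IH -mword_cat. Qed.

(* The constant term of the image of a letter vanishes, since the letter is nilpotent. *)
Lemma acoef_nil_letter j : acoef [::] (f (word1 [:: j])) = 0.
Proof.
have [k nLk] := nilL1 j; have : acoef [::] (f (word1 (nseq k j))) = 0.
  by rewrite mword_eq0 // raddf0 acoef0.
rewrite mword_nseq rmorphXn; elim: k {nLk} => [|k IH].
  by rewrite expr0 acoef1 // => /eqP; rewrite oner_eq0.
by rewrite exprS acoef_nilM => /eqP; rewrite mulf_eq0 => /orP[/eqP//|/eqP/IH].
Qed.

(** The degree 1 part of [f], which itself need not be graded. *)
Definition lin_part : 'M[F]_m := \matrix_(i, j) acoef [:: j] (f (word1 [:: i])).

(** Images of letters have no constant term, so the image of [w] starts in degree [size w], where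
    each letter contributes one degree 1 coefficient. *)
Lemma acoef_word w : (forall v, L2 v -> (size v < size w)%N -> acoef v (f (word1 w)) = 0) /\
  (forall v, L2 v -> size v = size w ->
     acoef v (f (word1 w)) = \prod_(p <- zip w v) lin_part p.1 p.2).
Proof.
elim: w => [|i w [IH0 IH]].
  split=> // -[|//] _ _; rewrite mword_nil rmorph1 acoef1 // big_nil //.
have drop_L v k : L2 v -> L2 (drop k v).
  by move=> Lv; apply: (Lfac2 (u := take k v) (w := [::])); rewrite cats0 cat_take_drop.
have -> : f (word1 (i :: w)) = f (word1 [:: i]) * f (word1 w).
  by rewrite -rmorphM -mword_cat.
split=> [v Lv vw|[//|j v] Lv [vw]].
  rewrite acoefM // big_ord_recl /= take0 acoef_nil_letter mul0r add0r.
  rewrite big1 // => k _; rewrite (IH0 (drop (bump 0 k) v)) ?mulr0 //; first exact: drop_L.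
  by rewrite size_drop /bump; move: vw (ltn_ord k) => /=; lia.
have Lj : L2 [:: j] by [].
have Lv' : L2 v by have := drop_L _ 1%N Lv; rewrite /= drop0.
rewrite acoefM // 2!big_ord_recl /= take0 acoef_nil_letter mul0r add0r drop0.
rewrite big1 ?addr0 => [|k _].
  by rewrite big_cons /= IH // mxE.
rewrite (IH0 (drop _ v)) ?mulr0 //; first exact: drop_L.
by rewrite size_drop /bump; move: (ltn_ord k); rewrite -/(size v) -vw; lia.
Qed.

(** A kernel vector is a linear form in the degree 1 coefficients that vanishes on the image of [f];
    by surjectivity it vanishes on all letters. *)
Lemma lin_part_unit : \det lin_part != 0.
Proof.
rewrite -det_tr; apply/det0P => -[y y0 yM].
have yf a : \sum_k y 0 k * acoef [:: k] (f a) = 0.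
  elim/alg_ind: a => [|a b IHa IHb|c w].
  - by rewrite big1 // => k _; rewrite raddf0 acoef0 // mulr0.
  - under eq_bigr => k _ do rewrite raddfD acoefD // mulrDr.
    by rewrite big_split IHa IHb; exact: addr0.
  under eq_bigr => k _ do rewrite linearZ acoefZ // mulrCA.
  rewrite -mulr_sumr; case: w => [|i [|i' w]].
  - rewrite big1 ?mulr0 // => k _; rewrite mword_nil rmorph1 acoef1 // mulr0 //.
  - have yMi : \sum_k y 0 k * acoef [:: k] (f (word1 [:: i])) = (y *m lin_part^T) 0 i.
      by rewrite mxE; apply: eq_bigr => k _; rewrite !mxE.
    by rewrite yMi yM mxE mulr0.
  rewrite big1 ?mulr0 // => k _; rewrite (acoef_word _).1 ?mulr0 //.
case/eqP: y0; apply/rowP => k; rewrite mxE.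
have [a fa] := f_surj (word2 [:: k]).
have := yf a; rewrite fa (bigD1 k) //= acoef_mword // eqxx mulr1 big1 ?addr0 // => j jk.
by rewrite acoef_mword //; case: eqP => [[kj]|]; [case/eqP: jk|rewrite mulr0].
Qed.

(** The coefficient of [v] in the image of [map p v] is a product of entries [lin_part (p j) j],
    nonzero by the choice of [p]; so [map p v] is nonzero in [A]. *)
Lemma surj_morphism_perm : exists2 p : 'I_m -> 'I_m, injective p &
  forall v, L2 v -> L1 (map p v).
Proof.
have [s sM] : exists s : 'S_m, \prod_i lin_part i (s i) != 0.
  apply: contrapT => /forallNP sM; case/eqP: lin_part_unit.
  rewrite /determinant big1 // => s _; have /negP/negPn/eqP -> := sM s.
  by rewrite mulr0.
pose p := invF (@perm_inj _ s); exists p; first exact: can_inj (f_invF (@perm_inj _ s)).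
move=> v Lv; apply: contrapT => nL1.
have := (acoef_word (map p v)).2 v Lv; rewrite size_map => /(_ erefl).
rewrite mword_eq0 // raddf0 acoef0 // => /esym/eqP; apply/negP.
elim: v {Lv nL1} => [|j v IH]; first by rewrite big_nil oner_eq0.
rewrite big_cons mulf_neq0 //=; move/prodf_neq0: sM => /(_ (p j) isT).
by rewrite /p f_invF.
Qed.

End Isomorphism.

(** * Point modules *)

Section Support.
Variables (K : fieldType) (m : nat).
Implicit Types (p : pspace K m) (Z : nat -> pspace K m) (w : seq 'I_m).

(** Nonvanishing of a homogeneous coordinate, without choosing a representative. *)
Definition psup p (j : 'I_m) : Prop := exists2 v : 'rV[K]_m, v \in val p & v 0 j != 0.

Fixpoint supported Z i w : Prop :=
  if w is j :: w' then psup (Z i) j /\ supported Z i.+1 w' else True.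

Lemma psup_line p lam j : val p = <[lam]>%VS -> psup p j <-> lam 0 j != 0.
Proof.
move=> pE; split=> [[v]|lj]; last by exists lam; rewrite // pE memv_line.
by rewrite pE => /vlineP[c ->]; rewrite mxE; apply: contraNneq => ->; rewrite mulr0.
Qed.

Definition prep p : 'rV[K]_m := vpick (val p).

Lemma prepE p : val p = <[prep p]>%VS.
Proof.
case: p => U U1; rewrite /prep /=; apply/eqP; rewrite eq_sym eqEdim -memvE memv_pick.
rewrite dim_vline vpick0 -dimv_eq0 (eqP U1) //.
Qed.

Lemma psup_prep p j : psup p j <-> prep p 0 j != 0.
Proof. by apply: psup_line; exact: prepE. Qed.

Lemma psup_ex p : exists j, psup p j.
Proof.
have p0 : prep p != 0.
  by rewrite vpick0 -dimv_eq0 (eqP (valP p)).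
case/rV0Pn: p0 => j pj; exists j; exact/psup_prep.
Qed.

End Support.

Section PointModules.
Variables (K : fieldType) (m : nat) (L : set (seq 'I_m)) (L0 : L [::]).
Hypothesis Lfac : factorial_lang L.
Local Notation D := (lang_data L0).
Local Notation A := (monomial_algebra K D).
Local Notation R := (free_algebra K m).

Lemma rm_act0 (M : right_module A) (x : M) : rm_act x 0 = 0.
Proof.
have := rm_linr x 1 0 0; rewrite !scale1r addr0 => /(congr1 (fun y => y - rm_act x 0)).
by rewrite addrK subrr.
Qed.

Lemma rm_actZ (M : right_module A) c (x : M) a : rm_act (c *: x) a = c *: rm_act x a.
Proof.
have := rm_linl a 1 (0 : M) 0; rewrite !scale1r addr0.
move=> /(congr1 (fun y => y - rm_act (0 : M) a)).
rewrite addrK subrr => /esym x0; have := rm_linl a c x 0.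
by rewrite !addr0 x0 addr0.
Qed.

(** A supported word carries [e i] to a nonzero multiple of a basis vector, so it cannot be a
    relation. *)
Lemma point_sequence_supported (Z : nat -> pspace K m) : @point_sequence K D Z ->
  forall i w, supported Z i w -> L w.
Proof.
case=> [P [e [lam [eP elam Zlam]]]] i w Zw; apply: contrapT => nLw.
have e0 n : e n != 0.
  have [b [bP bf bV]] := pm_dim1 P n; apply/eqP => en0.
  have : b ord0 = 0 by have := bP ord0; rewrite eP => -[c _ <-]; rewrite en0 scaler0.
  move=> b0; have := bf (fun=> 1) _ ord0; rewrite big_ord1 b0 scaler0 => /(_ erefl)/eqP.
  by rewrite oner_eq0.
have act : exists2 c, c != 0 & rm_act (e i) (mword K L0 w) = c *: e (i + size w)%N.
  elim: w i Zw {nLw} => [|j w IH] i /=.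
    by exists 1; rewrite ?oner_eq0 // mword_nil rm_act1 addn0 scale1r.
  case=> /(psup_line _ (Zlam i)) lij /IH[c c0 cE].
  exists (lam i 0 j * c); first by rewrite mulf_neq0.
  rewrite -cat1s mword_cat rm_actM.
  have -> : rm_act (e i) (mword K L0 [:: j]) = lam i 0 j *: e i.+1 by exact: elam.
  by rewrite rm_actZ cE scalerA addSnnS.
case: act => c c0; rewrite mword_eq0 // rm_act0 => /esym/eqP.
by rewrite scaler_eq0 (negPf c0) (negPf (e0 _)).
Qed.

(** * The point module with prescribed scalars *)

Section Construction.
Variable lam : nat -> 'rV[K]_m.

(** The module lives on polynomials, with ['X^i] in the role of [e i]. *)
Definition letter_act (x : {poly K}) (j : 'I_m) : {poly K} :=
  \poly_(i < (size x).+1) (if i is i'.+1 then x`_i' * lam i' 0 j else 0).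

Lemma coef_letter_act x j i :
  (letter_act x j)`_i = if i is i'.+1 then x`_i' * lam i' 0 j else 0.
Proof.
rewrite coef_poly; case: ltnP => // ; case: i => // i; rewrite ltnS => xi.
by rewrite nth_default // mul0r.
Qed.

Definition word_act (x : {poly K}) (w : seq 'I_m) : {poly K} := foldl letter_act x w.

Lemma letter_act_linear c x y j :
  letter_act (c *: x + y) j = c *: letter_act x j + letter_act y j.
Proof.
apply/polyP => -[|i]; rewrite coefD coefZ !coef_letter_act ?mulr0 ?addr0 //.
by rewrite coefD coefZ mulrDl mulrA.
Qed.

Lemma word_act_linear c x y w : word_act (c *: x + y) w = c *: word_act x w + word_act y w.
Proof. by elim: w x y => //= j w IH x y; rewrite letter_act_linear IH. Qed.

Lemma word_act0 w : word_act 0 w = 0.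
Proof.
by have := word_act_linear (-1) 0 0 w; rewrite !scaleN1r oppr0 addr0 addNr.
Qed.

Lemma word_actZ c x w : word_act (c *: x) w = c *: word_act x w.
Proof. by have := word_act_linear c x 0 w; rewrite word_act0 !addr0. Qed.

Definition word_weight i (w : seq 'I_m) : K :=
  \prod_(kj <- zip (iota i (size w)) w) lam kj.1 0 kj.2.

Lemma word_act_Xn i w : word_act 'X^i w = word_weight i w *: 'X^(i + size w).
Proof.
elim: w i => [|j w IH] i; first by rewrite /word_weight /= big_nil scale1r addn0.
rewrite /word_weight /= big_cons /= -/(word_weight i.+1 w).
have -> : letter_act 'X^i j = lam i 0 j *: 'X^(i.+1).
  apply/polyP => -[|k]; rewrite coef_letter_act coefZ !coefXn ?mulr0 // eqSS.
  by case: eqP => [->|]; rewrite ?mul1r ?mulr1 ?mul0r ?mulr0.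
by rewrite word_actZ IH scalerA addSnnS.
Qed.

Lemma word_actE x w :
  word_act x w = \sum_(i < size x) (x`_i * word_weight i w) *: 'X^(i + size w).
Proof.
rewrite -{1}[x]coefK poly_def.
elim/big_rec2: _ => [|i p q _ <-]; first exact: word_act0.
by rewrite word_act_linear word_act_Xn scalerA.
Qed.

Definition free_act (x : {poly K}) (p : R) : {poly K} :=
  mmap (@polyC K) (fun w => word_act x (fmonom_val w)) p.

Lemma free_actD x : {morph free_act x : p q / p + q}. Proof. exact: mmapD. Qed.

Lemma free_act_word x c w : free_act x (c *: free_word K w) = c *: word_act x w.
Proof.
have -> : c *: free_word K w = << c *g FMonom w >> :> R.
  by apply/malgP => u; rewrite mcoeffZ /free_word [RHS]mcoeffU mcoeffU mulr_natr.
by rewrite /free_act mmapU /= mul_polyC.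
Qed.

Lemma free_act0 x : free_act x 0 = 0. Proof. exact: mmap0. Qed.

Lemma free_actZ c x p : free_act x (c *: p) = c *: free_act x p.
Proof.
elim/free_alg_ind: p => [|p q IHp IHq|d w]; first by rewrite scaler0 free_act0 scaler0.
  by rewrite scalerDr !free_actD scalerDr; congr (_ + _).
rewrite scale_free_word; apply: etrans (free_act_word _ _ _) _.
by rewrite free_act_word scalerA.
Qed.

Lemma free_act_linear c x y p : free_act (c *: x + y) p = c *: free_act x p + free_act y p.
Proof.
elim/free_alg_ind: p => [|p q IHp IHq|d w]; first by rewrite !free_act0 scaler0 addr0.
  by rewrite !free_actD IHp IHq scalerDr addrACA.
by rewrite !free_act_word word_act_linear scalerDr !scalerA mulrC.
Qed.

Lemma free_act0l p : free_act 0 p = 0.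
Proof. by have := free_act_linear (-1) 0 0 p; rewrite !scaleN1r oppr0 addr0 addNr. Qed.

Lemma free_act1 x : free_act x 1 = x.
Proof. by rewrite -free_word_nil -[free_word _ _]scale1r free_act_word scale1r. Qed.

Lemma free_actM x p q : free_act x (p * q) = free_act (free_act x p) q.
Proof.
elim/free_alg_ind: p => [|p p' IHp IHp'|c u]; first by rewrite mul0r free_act0 free_act0l.
  rewrite mulrDl !free_actD -[free_act x p]scale1r free_act_linear scale1r.
  by congr (_ + _); [exact: IHp|exact: IHp'].
elim/free_alg_ind: q => [|q q' IHq IHq'|d v]; first by rewrite mulr0 !free_act0.
  rewrite mulrDr !free_actD; congr (_ + _); [exact: IHq|exact: IHq'].
rewrite mul_free_word; apply: etrans (free_act_word _ _ _) _.
rewrite free_act_word free_act_word.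
by rewrite word_actZ scalerA [d * c]mulrC /word_act foldl_cat.
Qed.

Hypothesis lamL : forall i w, word_weight i w != 0 -> L w.

(** The elements acting as 0 on all polynomials form a two-sided ideal containing the words outside
    [L], so the action descends to the quotient. *)
Lemma free_act_cls x p : free_act x (repr (cls L0 p)) = free_act x p.
Proof.
have /quotient_eqP : cls L0 (repr (cls L0 p)) = cls L0 p by rewrite cls_repr.
rewrite ideal2E => /asboolP Iq.
have : forall y, free_act y (repr (cls L0 p) - p) = 0.
  apply: (Iq [set q | forall y, free_act y q = 0]); split=> [|_ /= [w /= nLw <-] y].
    split=> /= [y|q q' q0 q'0 y|q q' q0 y|q q' q0 y].
    - exact: free_act0.
    - by rewrite -[- q']scaleN1r free_actD free_actZ q0 q'0 scaler0 addr0.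
    - by rewrite free_actM.
    - by rewrite free_actM q0 free_act0l.
  rewrite -[free_word _ _]scale1r free_act_word scale1r word_actE big1 // => i _.
  have [->|/lamL//] := eqVneq (word_weight i w) 0.
  by rewrite mulr0 scale0r.
by move=> /(_ x)/eqP; rewrite -[- p]scaleN1r free_actD free_actZ scaleN1r subr_eq0 => /eqP.
Qed.

Definition poly_act (x : {poly K}) (a : A) : {poly K} := free_act x (repr a).

Lemma poly_act_linr x c a b : poly_act x (c *: a + b) = c *: poly_act x a + poly_act x b.
Proof.
rewrite /poly_act -{1}[a]cls_repr -{1}[b]cls_repr -clsZ -clsD free_act_cls.
by rewrite free_actD free_actZ.
Qed.

Lemma poly_act1 x : poly_act x 1 = x.
Proof. by rewrite /poly_act -cls1 free_act_cls free_act1. Qed.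

Lemma poly_actM x a b : poly_act x (a * b) = poly_act (poly_act x a) b.
Proof.
by rewrite /poly_act -{1}[a]cls_repr -{1}[b]cls_repr -clsM free_act_cls free_actM.
Qed.

Definition poly_module : right_module A :=
  @RightModule K A {poly K} poly_act (fun a c x y => free_act_linear c x y (repr a))
    poly_act_linr poly_act1 poly_actM.

Definition poly_comp (n : nat) : set poly_module :=
  [set c *: ('X^n : {poly K}) | c in [set: K]].

Lemma poly_act_mword x w : poly_act x (mword K L0 w) = word_act x w.
Proof. by rewrite /poly_act free_act_cls -[free_word _ _]scale1r free_act_word scale1r. Qed.

Lemma poly_comp_grading : is_grading poly_comp.
Proof.
split=> [n|x|N a aP sa0 n nN].
- split; first by exists 0 => //; rewrite scale0r.
  by move=> c _ _ [d _ <-] [e _ <-]; exists (c * d + e); rewrite // scalerDl scalerA.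
- exists (size (x : {poly K})), (fun n => (x : {poly K})`_n *: ('X^n : {poly K})); split.
    by move=> n; exists (x : {poly K})`_n.
  by rewrite -[LHS]coefK poly_def.
have /choice[c cE] k : exists d, a k = d *: ('X^k : {poly K}).
  by have [d _ <-] := aP k; exists d.
suff cn : c n = 0 by rewrite cE cn scale0r.
have := congr1 (fun p : {poly K} => p`_n) sa0; rewrite coef0 => <-.
rewrite (_ : \sum_(i < N) a i = \poly_(i < N) c i); first by rewrite coef_poly nN.
by rewrite poly_def; apply: eq_bigr => i _; rewrite cE.
Qed.

Lemma poly_comp_graded n k x a : poly_comp n x -> mon_homog k a ->
  poly_comp (n + k)%N (rm_act (r := poly_module) x a).
Proof.
case=> c _ <- [p pk <-]; rewrite /= /poly_act free_act_cls.
have : forall w, w \in msupp p -> size (fmonom_val w) = k by exact: pk.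
rewrite [X in free_act _ X]free_algE => sk.
have [sub0 subD] : is_subspace (poly_comp (n + k)%N).
  by have [+ _ _] := poly_comp_grading; apply.
rewrite big_seq; elim/big_rec: _ => [|w q wp IH]; first by rewrite free_act0.
rewrite free_actD free_act_word word_actZ word_act_Xn sk // !scalerA.
set d := (X in X *: _).
have Pd : poly_comp (n + k)%N (d *: ('X^(n + k) : {poly K})) by exists d.
by have := subD 1 _ _ Pd IH; rewrite scale1r.
Qed.

Lemma word_weight_cat i u v :
  word_weight i (u ++ v) = word_weight i u * word_weight (i + size u)%N v.
Proof. by rewrite /word_weight size_cat iotaD zip_cat ?size_iota // big_cat. Qed.

Hypothesis lam_neq0 : forall i, exists j, lam i 0 j != 0.

Lemma word_weight_neq0 n : exists2 w, size w = n & word_weight 0 w != 0.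
Proof.
elim: n => [|n [w wn w0]]; first by exists [::]; rewrite // /word_weight big_nil oner_eq0.
have [j nj] := lam_neq0 n; exists (rcons w j); first by rewrite size_rcons wn.
by rewrite -cats1 word_weight_cat mulf_neq0 // wn add0n /word_weight big_seq1.
Qed.

(** A word of length [i] and nonzero weight carries 1 to a nonzero multiple of ['X^i]. *)
Lemma poly_cyclic : exists2 x0, poly_comp 0 x0 &
  forall x : poly_module, exists a, x = rm_act x0 a.
Proof.
exists (1 : {poly K}); first by exists 1; rewrite // scale1r expr0.
move=> x; rewrite -[x]coefK poly_def.
elim/big_rec: _ => [|i y _ [a ->]]; first by exists 0; rewrite rm_act0.
have [w wi w0] := word_weight_neq0 i.
exists ((x : {poly K})`_i / word_weight 0 w *: mword K L0 w + a).
have actw : poly_act 1 (mword K L0 w) = word_weight 0 w *: 'X^i.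
  by rewrite poly_act_mword -(expr0 'X) word_act_Xn wi.
by rewrite [RHS]poly_act_linr actw scalerA divfK.
Qed.

Lemma poly_dim1 n : has_dim (poly_comp n) 1.
Proof.
exists (fun=> 'X^n : {poly K}); split=> [_|c|_ [c _ <-]].
- by exists 1; rewrite // scale1r.
- rewrite big_ord1 => /(congr1 (fun p : {poly K} => p`_n)).
  by rewrite coefZ coefXn eqxx mulr1 coef0 => c0 i; rewrite ord1.
by exists (fun=> c); rewrite big_ord1.
Qed.

Definition poly_point_module : point_module K D :=
  PointModule poly_comp_grading poly_comp_graded poly_cyclic poly_dim1.

End Construction.

(** Together with [point_sequence_supported] this turns point modules into a condition on supported
    words. *)
Lemma supported_point_sequence (Z : nat -> pspace K m) :
  (forall i w, supported Z i w -> L w) -> @point_sequence K D Z.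
Proof.
move=> ZL; pose lam i := prep (Z i).
have lamL i w : word_weight lam i w != 0 -> L w.
  move=> lw; apply: (ZL i); elim: w i lw => //= j w IH i.
  rewrite /word_weight /= big_cons mulf_eq0 negb_or => /andP[/psup_prep Zj /IH].
  by split.
have lam0 i : exists j, lam i 0 j != 0.
  by have [j /psup_prep] := psup_ex (Z i); exists j.
exists (poly_point_module lamL lam0), (fun i => 'X^i : {poly K}), lam; split=> // [i j|i].
  change (poly_act lam 'X^i (mword K L0 [:: j]) = lam i 0 j *: 'X^(i.+1)).
  by rewrite poly_act_mword // word_act_Xn /word_weight /= big_seq1 addn1.
exact: prepE.
Qed.

End PointModules.

(** * Point modules of Toeplitz words *)

Definition letter (b : bool) : 'I_2 := if b then ord_max else ord0.
Definition letter_val (i : 'I_2) : bool := i != ord0.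

Lemma letterK : cancel letter letter_val. Proof. by case. Qed.
Lemma letter_valK : cancel letter_val letter.
Proof. by case=> [[|[|]]] // i; apply: val_inj. Qed.

Definition tlang (s : nat -> bool) : set (seq 'I_2) :=
  [set w | occurs s (size w) (fun j => letter_val (nth ord0 w j))].

Lemma tlang0 s : tlang s [::]. Proof. by exists 0%N. Qed.

Lemma tlang_factorial s : factorial_lang (tlang s).
Proof.
move=> u v w; rewrite /tlang /= size_cat => /occurs_drop; rewrite size_cat.
move=> /(occurs_le (leq_addr _ _)); apply: eq_occurs => j jv.
by rewrite nth_cat ltnNge leq_addr /= addKn nth_cat jv.
Qed.

Definition tdata s : monomial_data := lang_data (tlang0 s).

Section PointTower.
Variable K : fieldType.
Local Notation PP := (pspace K 2).

Definition letter_row c : 'rV[K]_2 := delta_mx 0 (letter c).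

Lemma letter_line_dim c : \dim <[letter_row c]>%VS == 1%N.
Proof.
suff r0 : letter_row c != 0 by rewrite dim_vline r0.
by apply/eqP => /rowP/(_ (letter c))/eqP; rewrite !mxE !eqxx oner_eq0.
Qed.

Definition letter_pt c : PP :=
  exist (fun U : {vspace 'rV[K]_2} => \dim U == 1%N) _ (letter_line_dim c).

Lemma val_letter_pt c : val (letter_pt c) = <[letter_row c]>%VS.
Proof. by []. Qed.

Definition bsup (p : PP) (c : bool) : Prop := psup p (letter c).

Lemma bsup_ex p : exists c, bsup p c.
Proof. by have [j pj] := psup_ex p; exists (letter_val j); rewrite /bsup letter_valK. Qed.

Lemma bsup_letter b c : bsup (letter_pt b) c <-> c = b.
Proof.
rewrite /bsup (psup_line _ (val_letter_pt b)) mxE eqxx /= (can_eq letterK).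
by case: c b => [] []; rewrite /= ?mulr1n ?mulr0n ?oner_eq0 ?eqxx; split.
Qed.

Lemma bsup_uniq p b : (forall c, bsup p c -> c = b) -> p = letter_pt b.
Proof.
move=> pb; apply: val_inj; rewrite /= prepE.
have pE : prep p = prep p 0 (letter b) *: letter_row b.
  apply/rowP => j; rewrite !mxE eqxx /=; case: eqP => [->|jb]; first by rewrite mulr1.
  rewrite mulr0; apply/eqP/negPn/negP => /psup_prep; rewrite -[j]letter_valK.
  by move/pb => jb'; case: jb; rewrite -jb' letter_valK.
have pb0 : prep p 0 (letter b) != 0.
  have [c pc] := bsup_ex p; have cb := pb c pc; move/psup_prep: pc.
  by rewrite cb.
rewrite pE; apply/eqP; rewrite eqEdim -memvE memvZ ?memv_line //.
by rewrite !dim_vline scaler_eq0 negb_or pb0 /=; case: (_ != 0).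
Qed.

Lemma letter_pt_inj : letter_pt true <> letter_pt false.
Proof.
by move=> tf; have := (bsup_letter true true).2 erefl; rewrite tf => /bsup_letter.
Qed.

Definition ptower := tower letter_pt.

Lemma supportedP (Z : nat -> PP) i w :
  supported Z i w <->
  forall j, (j < size w)%N -> bsup (Z (i + j)%N) (letter_val (nth ord0 w j)).
Proof.
rewrite /bsup; elim: w i => [|a w IH] i //=; split.
  case=> Za /IH Zw [|j] jw; rewrite /= letter_valK ?addn0 //.
  by have := Zw j jw; rewrite letter_valK addSnnS.
move=> Zw; split; first by have := Zw 0%N isT; rewrite /= letter_valK addn0.
by apply/IH => j jw; have := Zw j.+1 jw; rewrite addSnnS.
Qed.

Lemma tower_point_sequence s ds P : all (ltn^~ 3)%N ds ->
  @point_sequence K (tdata s) (ptower s ds P).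
Proof.
move=> dsv; apply: supported_point_sequence => i w /supportedP Zw.
have [c0 c0P] := choice (fun j => bsup_ex (ptower s ds P j)).
(* A supported word starting at [i] is extended to the left by supported letters until it starts at
   0. *)
pose f j := if (j < i)%N then c0 j else letter_val (nth ord0 w (j - i)).
have /occurs_drop : occurs s (i + size w) f.
  apply: (tower_support bsup_letter (ds := ds) (P := P) dsv) => j jw.
  rewrite /f; case: ltnP => // ij; rewrite -{1}(subnKC ij); apply: Zw; lia.
apply: eq_occurs => j jw.
by rewrite /f ltnNge leq_addr /= addKn.
Qed.

Lemma point_sequence_tower s k (Z : nat -> PP) : @point_sequence K (tdata s) Z ->
  exists ds P, digits k ds /\ forall j, (j < 3 ^ k)%N -> Z j = ptower s ds P j.
Proof.
move=> /(point_sequence_supported (@tlang_factorial s)) ZL.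
apply: (support_tower bsup_ex bsup_uniq) => n f fZ.
have := ZL 0%N (mkseq (letter \o f) n); rewrite /tlang /= size_mkseq => ZL'.
have : occurs s n (fun j => letter_val (nth ord0 (mkseq (letter \o f) n) j)).
  apply: ZL'; apply/supportedP => j; rewrite size_mkseq => jn.
  by rewrite nth_mkseq //= letterK; exact: fZ.
by apply: eq_occurs => j jn; rewrite nth_mkseq //= letterK.
Qed.

End PointTower.

Lemma ltn_pow3 n : (n < 3 ^ n)%N.
Proof. exact: ltn_expl. Qed.

Lemma pow3K n : (3 ^ n).-1.+1 = (3 ^ n)%N.
Proof. by rewrite prednK // expn_gt0. Qed.

(** * Truncated point modules as towers *)

Section Levels.
Variable F : fieldType.
Local Notation X s := (point_proalg F (tdata s)).
Local Notation Xk s k := (X s (3 ^ k).-1).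

Lemma level_tower s n k (K : fieldType) (iota : {rmorphism F -> K}) (x : X s n K iota) :
  (n < 3 ^ k)%N -> exists ds P, digits k ds /\
    forall i : 'I_n.+1, val x i = ptower (K := K) s ds P i.
Proof.
case: x => /= q /set_mem[z /(point_sequence_tower k)[ds [P [dsv zE]]] ->] nk.
exists ds, P; split=> // i; rewrite ffunE zE //; exact: leq_trans (ltn_ord i) nk.
Qed.

Lemma tower_level s n ds (K : fieldType) (iota : {rmorphism F -> K}) P : all (ltn^~ 3)%N ds ->
  [ffun i : 'I_n.+1 => ptower (K := K) s ds P i] \in X s n K iota.
Proof.
by move=> dsv; apply/mem_set; exists (ptower s ds P); [exact: tower_point_sequence|].
Qed.

Lemma pro_iter_val s n d (K : fieldType) (iota : {rmorphism F -> K}) (x : X s (d + n)%N K iota)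
    (a : 'I_n.+1) (b : 'I_(d + n).+1) :
  a = b :> nat -> val (pro_iter x) a = val x b.
Proof.
elim: d x b => [|d IH] x b ab /=; first by congr (val x _); apply: val_inj.
have bd : (a < (d + n).+1)%N by rewrite (leq_trans (ltn_ord a)) // ltnS leq_addl.
rewrite (IH _ (Ordinal bd)) //= ffunE; congr (val x _); exact: val_inj.
Qed.

Lemma pro_trans_val s n n' (le : (n <= n')%N) (K : fieldType) (iota : {rmorphism F -> K})
    (x : X s n' K iota) (a : 'I_n.+1) (b : 'I_n'.+1) :
  a = b :> nat -> val (pro_trans le x) a = val x b.
Proof.
move=> ab; rewrite /pro_trans.
have cast_val p (e : n' = p) (c : 'I_p.+1) : c = b :> nat ->
    val (ecast n0 (X s n0 K iota) e x) c = val x b.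
  by case: p / e c => c cb; congr (val x _); exact: val_inj.
have bd : (a < (n' - n + n).+1)%N by rewrite subnK // ab.
by rewrite (@pro_iter_val _ _ _ _ _ _ _ (Ordinal bd)) // cast_val.
Qed.

Lemma pro_point_val s (K : fieldType) (iota : {rmorphism F -> K})
    (x : forall n, X s n K iota) n n' (a : 'I_n.+1) (b : 'I_n'.+1) :
  @pro_point F (X s) K iota x -> (n <= n')%N -> a = b :> nat -> val (x n) a = val (x n') b.
Proof.
move=> xP; elim: n' b => [|n' IH] b.
  rewrite leqn0 => /eqP n0; subst n => ab; congr (val (x _) _); exact: val_inj.
rewrite leq_eqVlt => /orP[/eqP n0|nn'] ab.
  by subst n; congr (val (x _) _); exact: val_inj.
have bd : (b < n'.+1)%N by rewrite -ab (leq_trans (ltn_ord a)).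
rewrite (IH (Ordinal bd)) // -xP /= ffunE; congr (val (x _) _); exact: val_inj.
Qed.

Lemma level_tower_pair s k (K : fieldType) (iota : {rmorphism F -> K}) (x : Xk s k K iota) :
  exists dP : seq nat * pspace K 2, digits k dP.1 /\
    forall i, val x i = ptower (K := K) s dP.1 dP.2 i.
Proof.
have [|ds [P dP]] := level_tower (k := k) x; last by exists (ds, P).
by rewrite pow3K.
Qed.

(** A pointwise choice; that the map built on it is given by polynomials is the content of
    [recode_regular]. *)
Definition decode s k (K : fieldType) (iota : {rmorphism F -> K}) (x : Xk s k K iota) :
  seq nat * pspace K 2 := sval (cid (level_tower_pair x)).

Lemma decode_digits s k (K : fieldType) (iota : {rmorphism F -> K}) (x : Xk s k K iota) :
  digits k (decode x).1.
Proof. exact: (svalP (cid (level_tower_pair x))).1. Qed.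

Lemma decodeE s k (K : fieldType) (iota : {rmorphism F -> K}) (x : Xk s k K iota) i :
  val x i = ptower s (decode x).1 (decode x).2 i.
Proof. exact: (svalP (cid (level_tower_pair x))).2. Qed.

Lemma digits_all k ds : digits k ds -> all (ltn^~ 3)%N ds.
Proof. by case/andP. Qed.

Lemma recode_subproof s t k (K : fieldType) (iota : {rmorphism F -> K}) (x : Xk s k K iota) :
  [ffun i : 'I_k.+1 => ptower t (flip_digits s t (decode x).1) (decode x).2 i]
    \in X t k K iota.
Proof. by apply: tower_level; apply: (digits_all (digits_flip _ _ (decode_digits x))). Qed.

(** The [k] classes are read from [3 ^ k] factors; keeping only the first [k.+1] recoded points
    gives a map to every level. *)
Definition recode s t k : point_maps (Xk s k) (X t k) :=
  fun K iota x => SigSub (recode_subproof t x).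

Lemma recodeE s t k (K : fieldType) (iota : {rmorphism F -> K}) (x : Xk s k K iota) i :
  val (recode t x) i = ptower t (flip_digits s t (decode x).1) (decode x).2 i.
Proof. by rewrite ffunE. Qed.


Section Isolate.
Variables (s : nat -> bool) (k : nat) (K : fieldType) (ds ds' : seq nat) (P' : pspace K 2).
Hypotheses (dsv : digits k ds) (dsv' : digits k ds').

(* Filling the hole with any letter supported by the other point gives two equal
   towers, so the digits agree. *)
Lemma isolate : (forall j, (j < 3 ^ k)%N -> j != hole_pos ds ->
    bsup (ptower s ds' P' j) (tower id s ds false j)) -> ds' = ds.
Proof.
move=> sup; have [c supc] := bsup_ex (ptower s ds' P' (hole_pos ds)).
have E j : tower id s ds c j = if j == hole_pos ds then c else tower id s ds false j.
  case: eqP => [->|/eqP jh]; first exact: tower_hole dsv.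
  exact: tower_nhole dsv jh.
have [c' c'E] : exists c', forall j, (j < 3 ^ k)%N -> tower id s ds c j = tower id s ds' c' j.
  apply: (tower_support_word (@bsup_letter K) (P := P')); first exact: digits_all dsv'.
  by move=> j jk; rewrite E; case: eqP => [->//|/eqP jh]; exact: sup.
have tf : true <> false by [].
by have [] := tower_inj tf dsv dsv' c'E.
Qed.

End Isolate.

End Levels.

(** * Monomials that test the letters of a point *)

Section ChoiceMonomial.
Variables (F : fieldType) (k m : nat) (g : 'I_k -> option 'I_m).

Definition choice_mon : {cmonom ('I_k * 'I_m)%type} :=
  [cmonom (g ij.1 == Some ij.2 : nat) | ij in [fset ij | ij : 'I_k * 'I_m]%fset]%M.

Definition choice_poly : mhpoly F k m := << 1 *g choice_mon >>.

Lemma choice_monE ij : choice_mon ij = (g ij.1 == Some ij.2 : nat).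
Proof. by rewrite /choice_mon cmE /= fsfunE in_fset /=. Qed.

Lemma choice_poly_homog : multihomogeneous (fun i => (g i != None : nat)) choice_poly.
Proof.
move=> mon; rewrite /choice_poly msuppU oner_eq0 inE => /eqP -> i.
case gi: (g i) => [j|].
  rewrite (bigD1 j) //= choice_monE /= gi eqxx big1 // => j' jj'.
  by rewrite choice_monE /= gi; case: eqP => // -[jj]; rewrite jj eqxx in jj'.
by rewrite big1 // => j _; rewrite choice_monE /= gi.
Qed.

Lemma mheval_choice (K : fieldType) (iota : {rmorphism F -> K}) (v : 'M[K]_(k, m)) :
  mheval iota choice_poly v = \prod_i (if g i is Some j then v i j else 1).
Proof.
rewrite /mheval /choice_poly msuppU oner_eq0 big_seq_fset1 mcoeffUU rmorph1 mul1r.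
apply: etrans (eq_bigr (fun ij => v ij.1 ij.2 ^+ (g ij.1 == Some ij.2 : nat))
  (fun ij _ => congr1 (GRing.exp _) (choice_monE ij))) _.
rewrite -(pair_bigA _ (fun i j => v i j ^+ (g i == Some j : nat))) /=; apply: eq_bigr => i _.
case gi: (g i) => [j|]; last by rewrite big1 // => j _; rewrite expr0.
rewrite (bigD1 j) //= eqxx expr1 big1 ?mulr1 // => j' jj'.
by case: eqP => [[jj]|]; [rewrite jj eqxx in jj'|rewrite expr0].
Qed.

End ChoiceMonomial.

Lemma vline_scale (K : fieldType) (vT : vectType K) (a : K) (v : vT) : a != 0 ->
  <[a *: v]>%VS = <[v]>%VS.
Proof.
move=> a0; apply/eqP; rewrite eqEdim -memvE memvZ ?memv_line //.
by rewrite !dim_vline scaler_eq0 negb_or a0 /=; case: (_ != 0).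
Qed.

Lemma hcoords_bsup (K : fieldType) k (q : mpspace K k 2) (v : 'M[K]_(k, 2)) i c :
  hcoords q v -> bsup (q i) c <-> v i (letter c) != 0.
Proof. by move=> qv; rewrite /bsup (psup_line _ (qv i)) mxE. Qed.

(** * Recoding as an isomorphism of proalgebraic varieties *)

Section Recode.
Variable F : fieldType.
Local Notation X s := (point_proalg F (tdata s)).
Local Notation Xk s k := (X s (3 ^ k).-1).

Section Regular.
Variables (s t : nat -> bool) (k : nat) (ds : seq nat).
Hypothesis dsv : digits k ds.
Local Notation N := ((3 ^ k).-1.+1).

Lemma hole_ltN : (hole_pos ds < N)%N.
Proof. by rewrite pow3K hole_pos_lt. Qed.

Definition holeN : 'I_N := Ordinal hole_ltN.

Definition choice_at (o : option 'I_2) (i : 'I_N) : option 'I_2 :=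
  if i == holeN then o else Some (letter (tower id s ds false i)).

(** Nonzero exactly at the points with classes [ds], by [skeleton_isolates] and [skeleton_val_neq0];
    it separates one projective line from the others. *)
Definition skeleton_val (K : fieldType) (v : 'M[K]_(N, 2)) : K :=
  \prod_(i | i != holeN) v i (letter (tower id s ds false i)).

Lemma mheval_choice_at o (K : fieldType) (iota : {rmorphism F -> K}) (v : 'M[K]_(N, 2)) :
  mheval iota (choice_poly F (choice_at o)) v =
    (if o is Some j then v holeN j else 1) * skeleton_val v.
Proof.
rewrite mheval_choice (bigD1 holeN) //= {1}/choice_at eqxx; congr (_ * _).
by apply: eq_bigr => i /negPf ih; rewrite /choice_at ih.
Qed.

Lemma choice_at_homog o :
  multihomogeneous (fun i => (i != holeN) || (o != None) : nat) (choice_poly F (choice_at o)).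
Proof.
move=> mon /choice_poly_homog H i; rewrite H /choice_at.
by case: (i == holeN).
Qed.

Lemma skeleton_isolates (K : fieldType) (iota : {rmorphism F -> K}) (y : Xk s k K iota) v :
  hcoords (val y) v -> skeleton_val v != 0 -> (decode y).1 = ds.
Proof.
move=> yv /prodf_neq0 vn; apply: (isolate (s := s) (P' := (decode y).2) dsv (decode_digits y)).
move=> j; rewrite -{1}(pow3K k) => jk jh.
have := decodeE y (Ordinal jk) => /= <-; apply/(hcoords_bsup _ _ yv).
exact: (vn (Ordinal jk)).
Qed.

Lemma skeleton_val_neq0 (K : fieldType) (iota : {rmorphism F -> K}) (x : Xk s k K iota) v :
  hcoords (val x) v -> (decode x).1 = ds -> skeleton_val v != 0.
Proof.
move=> xv xds; apply/prodf_neq0 => i ih; apply/(hcoords_bsup _ _ xv).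
rewrite decodeE xds /ptower (tower_nhole _ _ _ false dsv) //; exact/bsup_letter.
Qed.

End Regular.

(** All polynomials used have the factor [skeleton_val], so they vanish together off the line of
    [x], and the formula has to hold on that line only. *)
Lemma recode_regular s t k : is_regular (@recode F s t k).
Proof.
move=> K iota x i; set ds := (decode x).1; have dsv : digits k ds := decode_digits x.
have fdsv := digits_flip s t dsv.
have [ih|ih] := eqVneq (i : nat) (hole_pos (flip_digits s t ds)).
  (* At the new hole the recoded point is the point at the old hole. *)
  exists (fun=> 1%N), (fun j => choice_poly F (choice_at s dsv (Some j))).
  have rowE (L : fieldType) (kappa : {rmorphism F -> L}) (v : 'M[L]_((3 ^ k).-1.+1, 2)) :
      \row_j mheval kappa (choice_poly F (choice_at s dsv (Some j))) v =
        skeleton_val s dsv v *: row (holeN dsv) v.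
    by apply/rowP => j; rewrite mxE mheval_choice_at !mxE mulrC.
  split=> [j mon /choice_at_homog H i'|v xv|L kappa y v yv].
  - by rewrite H orbT.
  - rewrite rowE scaler_eq0 negb_or (skeleton_val_neq0 dsv xv) //=.
    exact: (hcoords_neq0 _ xv).
  rewrite rowE scaler_eq0 negb_or => /andP[v0 _]; rewrite vline_scale // -yv recodeE.
  rewrite (skeleton_isolates yv v0) ih /ptower (tower_hole _ _ _ fdsv) decodeE.
  by rewrite (skeleton_isolates yv v0) /ptower (tower_hole _ _ _ dsv).
(* Elsewhere the recoded point is a fixed coordinate point on this line, given by a row with one
   nonzero entry. *)
set c := tower id t (flip_digits s t ds) false i.
exists (fun i' => (i' != holeN dsv : nat)),
  (fun j => if j == letter c then choice_poly F (choice_at s dsv None) else 0).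
have rowE (L : fieldType) (kappa : {rmorphism F -> L}) (v : 'M[L]_((3 ^ k).-1.+1, 2)) :
    \row_j mheval kappa (if j == letter c then choice_poly F (choice_at s dsv None) else 0) v =
      skeleton_val s dsv v *: letter_row L c.
  apply/rowP => j; rewrite !mxE eqxx /=; case: eqP => _.
    by rewrite mheval_choice_at mul1r mulr1.
  by rewrite /mheval msupp0 big_seq_fset0 mulr0.
split=> [j mon|v xv|L kappa y v yv].
- case: eqP => [_ /choice_at_homog H i'|_]; first by rewrite H orbF.
  by rewrite msupp0 inE.
- rewrite rowE scaler_eq0 negb_or (skeleton_val_neq0 dsv xv) //=.
  by have := letter_line_dim K c; rewrite dim_vline; case: (_ != 0).
rewrite rowE scaler_eq0 negb_or => /andP[v0 _]; rewrite vline_scale // recodeE.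
by rewrite (skeleton_isolates yv v0) /ptower (tower_nhole _ _ _ false fdsv ih).
Qed.

Lemma pow3_pred_homo j j' : (0 <= j)%N -> (j <= j')%N -> ((3 ^ j).-1 <= (3 ^ j').-1)%N.
Proof. by move=> _ jj'; rewrite -ltnS !pow3K leq_exp2l. Qed.

Definition recode_morphism s t j : morphism (Xk s j) (X t j) :=
  Morphism (@recode_regular s t j).

Lemma recode_compat s t j j' (hj : (0 <= j)%N) (hj' : (0 <= j')%N) (le : (j <= j')%N)
    (K : fieldType) (iota : {rmorphism F -> K}) (x : Xk s j' K iota) :
  recode_morphism s t j K iota (pro_trans (pow3_pred_homo hj le) x) =
    pro_trans le (recode_morphism s t j' K iota x).
Proof.
apply: val_inj; apply/ffunP => a.
have a' : (a < j'.+1)%N by rewrite (leq_trans (ltn_ord a)).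
rewrite [RHS](pro_trans_val _ _ (b := Ordinal a')) //.
rewrite /= !ffunE /=; set y := pro_trans _ x.
apply: (flip_restrict (@letter_pt_inj K) t (decode_digits y) (decode_digits x) le).
  move=> i; rewrite -{1}(pow3K j) => ij.
  have ij' : (i < (3 ^ j').-1.+1)%N.
    by apply: (leq_trans ij); rewrite !pow3K leq_exp2l.
  have := decodeE y (Ordinal ij); rewrite (pro_trans_val _ _ (b := Ordinal ij')) // decodeE.
  by move=> /esym.
exact: leq_trans (ltn_ord a) (ltn_pow3 j).
Qed.

(* Level n of the proalgebraic variety has n + 1 factors, hence the index 3^j - 1. *)
Definition recode_pro s t : pro_morphism (X s) (X t) :=
  @ProMorphism F (X s) (X t) 0 (fun j => (3 ^ j).-1) pow3_pred_homo
    (fun j _ => recode_morphism s t j) (@recode_compat s t).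

(** By [flip_restrict], level [n] of the image can be computed from a tower description of [x] at
    any depth [k >= n]. *)
Lemma induced_recode s t (K : fieldType) (iota : {rmorphism F -> K})
    (x : forall n, X s n K iota) n k ds P : pro_point x -> (n <= k)%N -> digits k ds ->
  (forall i, val (x (3 ^ k).-1) i = ptower s ds P i) ->
  forall a, val (induced_map (recode_pro s t) x n) a = ptower t (flip_digits s t ds) P a.
Proof.
move=> xP nk dsv xE a.
have an : (a < (maxn 0 n).+1)%N by rewrite max0n.
rewrite /induced_map (pro_trans_val _ _ (b := Ordinal an)) // [LHS]recodeE /=.
set k0 := maxn 0 n; have k0k : (k0 <= k)%N by rewrite /k0 max0n.
set y := x _; rewrite -/k0 in y an *.
apply: (flip_restrict (@letter_pt_inj K) t (decode_digits y) dsv k0k).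
  move=> i; rewrite -{1}(pow3K k0) => ik0.
  have ik : (i < (3 ^ k).-1.+1)%N by apply: (leq_trans ik0); rewrite !pow3K leq_exp2l.
  apply: etrans (esym (decodeE y (Ordinal ik0))) (etrans _ (xE (Ordinal ik))).
  apply: (@pro_point_val F s K iota x (3 ^ k0).-1 (3 ^ k).-1 _ (Ordinal ik)) => //.
  by rewrite -ltnS !pow3K leq_exp2l.
exact: leq_trans an (ltn_pow3 k0).
Qed.

Lemma induced_recode_point s t (K : fieldType) (iota : {rmorphism F -> K})
    (x : forall n, X s n K iota) : pro_point x ->
  pro_point (induced_map (recode_pro s t) x).
Proof.
move=> xP n; apply: val_inj; apply/ffunP => a; set y := x (3 ^ n.+1).-1.
rewrite /= ffunE.
by rewrite !(induced_recode xP _ (decode_digits y) (decodeE y)).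
Qed.

Lemma induced_recodeK s t (K : fieldType) (iota : {rmorphism F -> K})
    (x : forall n, X s n K iota) : pro_point x -> forall n,
  induced_map (recode_pro t s) (induced_map (recode_pro s t) x) n = x n.
Proof.
move=> xP n; apply: val_inj; apply/ffunP => a.
(* The outer recoding reads the inner one at level [k], hence [x] at the level of [z];
   [flip_restrict] compares [z] with [y]. *)
set y := x (3 ^ n).-1; set k := (3 ^ n).-1; set z := x (3 ^ k).-1.
have nk : (n <= k)%N by rewrite -ltnS pow3K ltn_pow3.
have fv := digits_flip s t (decode_digits y).
rewrite (induced_recode (induced_recode_point t xP) (leqnn n) fv (P := (decode y).2)).
  rewrite (flip_digitsK _ _ (decode_digits y)).
  have an : (a < (3 ^ n).-1.+1)%N by rewrite pow3K (leq_trans (ltn_ord a)) // ltn_pow3.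
  apply: etrans (esym (decodeE y (Ordinal an))) _; symmetry.
  exact: (@pro_point_val F s K iota x n (3 ^ n).-1 a (Ordinal an)).
move=> i; rewrite (induced_recode xP (leqnn k) (decode_digits z) (decodeE z)).
symmetry; apply: (flip_restrict (@letter_pt_inj K) t (decode_digits y) (decode_digits z) nk).
  move=> j; rewrite -{1}(pow3K n) => jn.
  have jk : (j < (3 ^ k).-1.+1)%N by rewrite pow3K (leq_trans jn) // pow3K leq_exp2l.
  apply: etrans (esym (decodeE y (Ordinal jn))) (etrans _ (decodeE z (Ordinal jk))).
  apply: (@pro_point_val F s K iota x (3 ^ n).-1 (3 ^ k).-1 _ (Ordinal jk)) => //.
  by rewrite -ltnS !pow3K leq_exp2l.
have : (i < (3 ^ n).-1.+1)%N := ltn_ord i; by rewrite pow3K.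
Qed.

Lemma tdata_pro_isomorphic s t : pro_isomorphic (X s) (X t).
Proof.
exists (recode_pro s t), (recode_pro t s) => K iota.
by split=> x xP n; exact: induced_recodeK.
Qed.

End Recode.

(* The algebras of Toeplitz words *)
Local Close Scope ring_scope.

Lemma tlang_mkseq s n f : occurs s n f -> tlang s (mkseq (letter \o f) n).
Proof.
rewrite /tlang /= size_mkseq; apply: eq_occurs => j jn.
by rewrite nth_mkseq //= letterK.
Qed.

Lemma tlang_infinite s n : exists2 w, tlang s w & size w = n.
Proof.
by exists (mkseq (letter \o (fun j => toep s (1 + j))) n);
  [apply: tlang_mkseq; exact: occurs_id|rewrite size_mkseq].
Qed.

Lemma tlang_recurrent s w : tlang s w -> exists N, forall z, tlang s z ->
  N <= size z -> exists u v, z = u ++ w ++ v.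
Proof.
case/occurs_recurrent=> N NP; exists N => z [i zi] Nz.
have [i' [ii' i'N wi']] := NP i.
exists (take (i' - i) z), (drop (size w) (drop (i' - i) z)).
have -> : w = take (size w) (drop (i' - i) z).
  apply: (@eq_from_nth _ ord0) => [|j jw]; first by rewrite size_takel // size_drop; lia.
  rewrite nth_take // nth_drop; apply: (can_inj letter_valK); rewrite wi' // zi; last by lia.
  by congr toep; lia.
by rewrite size_takel ?cat_take_drop // size_drop; lia.
Qed.

Lemma tdata_projectively_simple F s : projectively_simple F (tdata s).
Proof.
exact: lang_projectively_simple (@tlang_factorial s) (@tlang_infinite s) (@tlang_recurrent s).
Qed.

Lemma count_tlang s n : exists2 ws : seq (seq 'I_2),
  uniq ws /\ (forall w, w \in ws <-> tlang s w /\ size w = n) &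
  size ws = if n == 0 then 1 else 2 * n.
Proof.
have [ws [uws wsP] wsn] := count_words s n.
exists (map (map letter) ws); last by rewrite size_map.
split; first by rewrite map_inj_uniq //; exact: inj_map (can_inj letterK).
move=> w; split=> [/mapP[v /wsP[vn sv] ->]|[sw wn]].
  rewrite size_map; split=> //; rewrite /tlang /= size_map vn.
  by apply: eq_occurs sv => j jn; rewrite (nth_map false) ?vn // letterK.
apply/mapP; exists (map letter_val w); last first.
  by rewrite -map_comp map_id_in // => i _; exact: letter_valK.
apply/wsP; rewrite size_map wn; split=> //; move: sw; rewrite /tlang /= wn.
by apply: eq_occurs => j jn; rewrite (nth_map ord0) ?wn.
Qed.

Lemma hilbert_tdata F s n : hilbert_series F (tdata s) n = if n == 0 then 1 else 2 * n.
Proof.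
have [ws [uws wsP] <-] := count_tlang s n.
exact: (hilbert_seriesE F (tlang0 s) (@tlang_factorial s) uws wsP).
Qed.

(** The sum [1 + 2 + 4 + ... + 2 * n] of the numbers of words. *)
Lemma growth_tdata F s n : growth_function F (tdata s) n = n ^ 2 + n + 1.
Proof.
suff [ws [uws wsP] <-] : exists2 ws : seq (seq 'I_2),
    uniq ws /\ (forall w, w \in ws <-> tlang s w /\ size w <= n) & size ws = n ^ 2 + n + 1.
  exact: (growth_functionE F (tlang0 s) (@tlang_factorial s) uws wsP).
elim: n => [|n [ws [uws wsP] wsn]].
  have [ws [uws wsP] wsn] := count_tlang s 0; exists ws => //; split=> // w.
  by rewrite wsP; split=> -[sw]; [move=> ->|rewrite leqn0 => /eqP].
have [vs [uvs vsP] vsn] := count_tlang s n.+1; exists (ws ++ vs).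
  split=> [|w].
    rewrite cat_uniq uws uvs andbT; apply/hasPn => w /vsP[_ wn].
    by apply/negP => /wsP[_]; rewrite wn ltnn.
  rewrite mem_cat; split=> [/orP[/wsP[sw wn]|/vsP[sw ->]]|[sw]] //.
    by split=> //; exact: leqW.
  rewrite leq_eqVlt => /orP[/eqP wn|wn]; apply/orP; first by right; apply/vsP.
  by left; apply/wsP.
by rewrite size_cat wsn vsn /=; lia.
Qed.

Lemma tdata_quadratic F s : quadratic_growth F (tdata s).
Proof.
(* For [n > 0], [n ^ 2 + n + 1 <= (2 * n) ^ 2]; the other comparison holds with constant 1. *)
by split; [exists 2|exists 1] => // n n0; rewrite growth_tdata; nia.
Qed.

Lemma alg_isomorphic_occurs (F : fieldType) s t :
  alg_isomorphic (monomial_algebra F (tdata s)) (monomial_algebra F (tdata t)) ->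
  exists2 c : bool -> bool, injective c &
    forall n q, occurs t n q -> occurs s n (fun j => c (q j)).
Proof.
case=> f [g _ gK].
(* No letter occurs three times in a row, so its cube is 0. *)
have nil_letter j : exists k, ~ tlang s (nseq k j).
  by exists 3 => /occurs_aaa[].
have letters j : tlang t [:: j] by apply: (@occurs_le _ _ 2) => //; exact: occurs2.
have f_surj b : exists a, f a = b by exists (g b).
have [p p_inj pP] := surj_morphism_perm (f := f) (@tlang_factorial s) (@tlang_factorial t)
  nil_letter letters f_surj.
exists (fun b => letter_val (p (letter b))).
  by apply: (inj_comp (can_inj letter_valK)); apply: inj_comp p_inj (can_inj letterK).
move=> n q /tlang_mkseq/pP; rewrite /tlang /= size_map size_mkseq.
by apply: eq_occurs => j jn; rewrite (nth_map ord0) ?size_mkseq // nth_mkseq.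
Qed.

(* Exchanging the two letters complements the sequence [s], so its first term is fixed. *)
Definition pad (s : nat -> bool) (k : nat) : bool := if k is k'.+1 then s k' else false.

Lemma pad_nonisomorphic (F : fieldType) s t : s <> t ->
  ~ alg_isomorphic (monomial_algebra F (tdata (pad s))) (monomial_algebra F (tdata (pad t))).
Proof.
move=> st /alg_isomorphic_occurs[c c_inj cP].
have [cid|cneg] : (forall b, c b = b) \/ (forall b, c b = ~~ b).
  case E: (c true); case E': (c false).
  - by have := c_inj true false; rewrite E E' => /(_ erefl).
  - by left=> -[].
  - by right=> -[].
  - by have := c_inj true false; rewrite E E' => /(_ erefl).
- case: st; apply/funext => k; have ts : pad t =1 pad s.
    by apply: occurs_sub_eq => n q /cP; apply: eq_occurs => j _; rewrite cid.
  by have := ts k.+1.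
(* The exchange would make [pad s 0] and [pad t 0] opposite, but both are [false]. *)
have /occurs_sub_swap/(_ 0) // : forall n q, occurs (pad t) n q ->
  occurs (pad s) n (fun j => ~~ q j).
by move=> n q /cP; apply: eq_occurs => j _; rewrite cneg.
Qed.

Theorem corollary10p5 (F : fieldType) :
  exists D : (nat -> bool) -> monomial_data,
    [/\ forall s, projectively_simple F (D s),
        forall s, quadratic_growth F (D s),
        forall s t, hilbert_series F (D s) = hilbert_series F (D t),
        forall s t, s <> t ->
          ~ alg_isomorphic (monomial_algebra F (D s)) (monomial_algebra F (D t)) &
        forall s t, pro_isomorphic (point_proalg F (D s)) (point_proalg F (D t))].
Proof.
exists (fun s => tdata (pad s)); split=> [s|s|s t|s t st|s t].
- exact: tdata_projectively_simple.
- exact: tdata_quadratic.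
- by apply/funext => n; rewrite !hilbert_tdata.
- exact: pad_nonisomorphic.
- exact: tdata_pro_isomorphic.
Qed.
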